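(* Let $n,k_1,\dots,k_n\in\mathbb N$, let $F\in \mathcal O_\Delta^n+\mathcal O_{\mathrm{loc}}^n$ and $G_i\in\mathcal O_\Delta^{k_i}+\mathcal O_{\mathrm{loc}}^{k_i}$ for $i=1,\dots,n$. For $p_G=(p_{G_1},\dots,p_{G_n})$ with $p_{G_i}\in(\mathbb R^{d*})^{k_i}$, and $x_G=(x_{G_1},\dots,x_{G_n})\in(\mathbb R^d)^n$, put $$G_1\cup\dots\cup G_n(p_G,x_G):=G_1(p_{G_1},x_{G_1})+\dots+G_n(p_{G_n},x_{G_n}).$$ Consider the function $\phi$ of $(p_G,x_F)$ (with $x_F\in\mathbb R^d$) defined near $B^0_{k_1+\dots+k_n}$ by $$\phi(p_G,x_F)=G_1\cup\dots\cup G_n(p_G,x_G)+F(p_F,x_F)-x_G\,p_F,$$ where $(p_F,x_G)$ is determined by the implicit equations $$p_F=\nabla_x\big(G_1\cup\dots\cup G_n\big)(p_G,x_G),\qquad x_G=\nabla_pF(p_F,x_F),$$ with $(p_{G_i},x_{G_i})$ in the domain of $G_i$ for all $i$ and $(p_F,x_F)$ in the domain of $F$. Then $$\phi\in\mathcal O_\Delta^{k_1+\dots+k_n}+\mathcal O_{\mathrm{loc}}^{k_1+\dots+k_n}\qquad\text{and}\qquad L_\phi=L_F(L_{G_1},\dots,L_{G_n}).$$ In other words, the sets $\mathcal O_\Delta^n+\mathcal O_{\mathrm{loc}}^n$, $n\ge 0$, together with the compositions $F(G_1,\dots,G_n):=\phi$, form an operad. Moreover, the induced operad structure on $\mathcal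 O_{\mathrm{loc}}$ is given as follows: for $\tilde F\in\mathcal O_{\mathrm{loc}}^n$, $\tilde G_i\in\mathcal O_{\mathrm{loc}}^{k_i}$ and $\tilde G:=\tilde G_1\cup\dots\cup\tilde G_n$, one has $R(\tilde F;\tilde G_1,\dots,\tilde G_n)=H$, where $H\in\mathcal O_{\mathrm{loc}}^{k_1+\dots+k_n}$ is defined by $$H(p_G,x_F)=\tilde G(p_G,x_G)+\tilde F(p_F,x_F)-\nabla_p\tilde F(p_F,x_F)\,\nabla_x\tilde G(p_G,x_G),$$ $$p_F=p_F^0+\nabla_x\tilde G(p_G,x_G),\quad p_F^0:=(p_{G_1}^\Sigma,\dots,p_{G_n}^\Sigma),\qquad x_G=x_G^0+\nabla_p\tilde F(p_F,x_F),\quad x_G^0:=(x_F,\dots,x_F).$$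
   Context: Fix $d\ge1$. For $n\ge0$ let $B_n:=(\mathbb R^{d*})^n\times\mathbb R^d$ with points $(p,x)=(p_1,\dots,p_n,x)$, and $B_n^0:=\{0\}\times\mathbb R^d\subset B_n$. Write $p^\Sigma:=p_1+\dots+p_n$. Let $S_0^n(p_1,\dots,p_n,x):=(p_1+\dots+p_n)x$ (pairing of $\mathbb R^{d*}$ with $\mathbb R^d$; $S_0^0=0$), and $\mathcal O_\Delta^n:=\{S_0^n\}$. $\mathcal O_{\mathrm{loc}}^n$ is the vector space of germs at $B_n^0$ of smooth real functions $\tilde F$ (each defined on an open neighborhood of $B_n^0$ in $B_n$) satisfying $\tilde F(0,x)=0$ and $\nabla_p\tilde F(0,x)=0$ for all $x$. $\mathcal O_\Delta^n+\mathcal O_{\mathrm{loc}}^n=\{S_0^n+\tilde F:\tilde F\in\mathcal O^n_{\mathrm{loc}}\}$. For $F\in\mathcal O_\Delta^n+\mathcal O_{\mathrm{loc}}^n$, $L_F\subset\overline{(T^*\mathbb R^d)^n}\times T^*\mathbb R^d$ is the Lagrangian submanifold (the graph of $dF$ after identification with $T^*B_n$) $$L_F=\{((p_1,\nabla_{p_1}F(z)),\dots,(p_n,\nabla_{p_n}F(z)),(\nabla_xF(z),x)) : z=(p_1,\dots,p_n,x)\}.$$ Here $\overline M$ is the symplectic manifold $M$ with the opposite symplectic form. The composition of Lagrangians is $L_F(L_{G_1},\dots,L_{G_n}):=L_F\circ(L_{G_1}\otimes\dots\otimes L_{G_n})$, where $\circ$ is composition of canonical relations ($\tilde L\circ L=\{(m,p):\exists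 n,\ (m,n)\in L,\ (n,p)\in\tilde L\}$) and $L_1\otimes L_2=\{(m,a,n,b):(m,n)\in L_1,(a,b)\in L_2\}$. All compositions are understood in terms of germs: all functions are considered for $(p_G,x_F)$ in a sufficiently small neighborhood of $B^0_{k_1+\dots+k_n}$, with $(p_F,x_G)$ the solution of the implicit system which equals $(0,(x_F,\dots,x_F))$ at $p_G=0$. An operad (here: non-symmetric) consists of sets $\mathcal O^n$, $n\ge0$, composition laws $\mathcal O^n\times\mathcal O^{k_1}\times\dots\times\mathcal O^{k_n}\to\mathcal O^{k_1+\dots+k_n}$, $(F,G_1,\dots,G_n)\mapsto F(G_1,\dots,G_n)$, satisfying $F(G_1,\dots,G_n)(H_{11},\dots,H_{nk_n})=F(G_1(H_{11},\dots,H_{1k_1}),\dots,G_n(H_{n1},\dots,H_{nk_n}))$, and a unit $I\in\mathcal O^1$ with $F(I,\dots,I)=F$. Here the unit is $I=S_0^1$, $I(p,x)=px$. The induced operad structure on $\mathcal O_{\mathrm{loc}}$ is the one with unit $0\in\mathcal O_{\mathrm{loc}}^1$ and composition $R$ defined by $$(S_0^n+\tilde F)(S_0^{k_1}+\tilde G_1,\dots,S_0^{k_n}+\tilde G_n)=S_0^{k_1+\dots+k_n}+R(\tilde F;\tilde G_1,\dots,\tilde G_n).$$ *)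

(* Defs.v *)
From HB Require Import structures.
From mathcomp Require Import all_boot all_order all_algebra generic_quotient.
From mathcomp Require Import boolp classical_sets functions reals.
From mathcomp Require Import topology tvs normedtype derive.

Set Implicit Arguments.
Unset Strict Implicit.
Unset Printing Implicit Defensive.

Import Order.TTheory GRing.Theory Num.Theory numFieldNormedType.Exports.

Local Open Scope quotient_scope.
Local Open Scope classical_set_scope.
Local Open Scope ring_scope.

(* Covectors (elements of R^d* ) are rows, vectors (elements of R^d) are
   columns.  A tuple (p_1, ..., p_n) of covectors is the matrix in 'M_(n, d)
   with rows p_i; a tuple (x_1, ..., x_n) of vectors is the matrix in 'M_(d, n)
   with columns x_i.  The concatenation p_G = (p_G1, ..., p_Gn) of blocks of
   k_1, ..., k_n covectors has \sum_i k_i rows, and p_Gi is submxcol p_G i. *)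

Section Smooth.
Context {R : realType} {V W : normedModType R}.
Implicit Types (U : set V) (f : V -> W).

Fixpoint Ck_on (k : nat) U f : Prop :=
  if k is k'.+1 then
    (forall z, U z -> differentiable f z) /\
    (forall v, Ck_on k' U (fun z => 'D_v f z))
  else forall z, U z -> {for z, continuous f}.

Definition smooth_on U f : Prop := forall k, Ck_on k U f.

Lemma smooth_on_cst U (a : W) : smooth_on U (fun=> a).
Proof.
move=> k; elim: k a => [|k IH] a /=; first by move=> z _; exact: cst_continuous.
split=> [z _|v]; first exact: differentiable_cst.
have -> : (fun z => 'D_v (fun=> a : W) z) = fun=> (0 : W).
  by apply/funext => z; exact: derive_cst.
exact: IH.
Qed.

End Smooth.

Section Functions.
Context {R : realType} {d : nat}.

(* (p_1, ..., p_m; x_1, ..., x_l); both (T^*R^d)^m (when l = m) and the domain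
   of G_1 \cup ... \cup G_n are of this form *)
Definition phase (m l : nat) := ('M[R]_(m, d) * 'M[R]_(d, l))%type.

Definition B (n : nat) := phase n 1.
Definition B0 (n : nat) : set (B n) := [set z | z.1 = 0].

(* \sum_i p_i x_i *)
Definition pairing (m : nat) (p : 'M[R]_(m, d)) (x : 'M[R]_(d, m)) : R :=
  \tr (p *m x).

Definition psum (n : nat) (p : 'M[R]_(n, d)) : 'rV[R]_d := \sum_i row i p.

Definition S0 (n : nat) (z : B n) : R := pairing (psum z.1) z.2.
Arguments S0 : clear implicits.

(* (x, ..., x) *)
Definition xdiag (n : nat) (x : 'cV[R]_d) : 'M[R]_(d, n) := \matrix_(j, i) x j 0.

(* column i is the gradient in p_i, which is a vector *)
Definition nabla_p (m l : nat) (f : phase m l -> R) (z : phase m l)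
    : 'M[R]_(d, m) :=
  \matrix_(j, i) 'D_(delta_mx i j, 0) f z.

(* row i is the gradient in x_i, which is a covector *)
Definition nabla_x (m l : nat) (f : phase m l -> R) (z : phase m l)
    : 'M[R]_(l, d) :=
  \matrix_(i, j) 'D_(0, delta_mx j i) f z.

(* F restricted to U is a smooth function on an open neighbourhood of B0 that
   represents an element of O_loc.  Functions are total, with irrelevant values
   outside U, so U is the domain of the partial function. *)
Definition Oloc_on (n : nat) (U : set (B n)) (F : B n -> R) : Prop :=
  [/\ open U, @B0 n `<=` U, smooth_on U F,
      forall x, F (0, x) = 0 & forall x, nabla_p F (0, x) = 0].

Definition ODL_on (n : nat) (U : set (B n)) (F : B n -> R) : Prop :=
  exists2 Ft, Oloc_on U Ft & forall z, U z -> F z = S0 n z + Ft z.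

Lemma Oloc_on0 (n : nat) : @Oloc_on n setT (fun=> 0).
Proof.
split=> //; first exact: openT; first exact: smooth_on_cst.
by move=> x; apply/matrixP=> j i; rewrite !mxE derive_cst.
Qed.

End Functions.

Arguments S0 {R d} n z.
Arguments B0 {R d} n.
Arguments phase R d m l : clear implicits.
Arguments B R d n : clear implicits.

Section Germs.
Context {R : realType} {d : nat}.

Definition germ_eqv (n : nat) (F G : B R d n -> R) : bool :=
  `[< set_nbhs (B0 n) [set z | F z = G z] >].

Lemma germ_eqv_equiv (n : nat) :
  equiv_class_of (@germ_eqv n).
Proof.
split=> [F|F G|G F H].
- by apply/asboolP => z _; apply: filterE.
- by apply: asbool_equiv_eq; split=> FG z /FG; apply: filterS => y /= ->.
- move=> /asboolP FG /asboolP GH; apply/asboolP => z z0.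
  by apply: filterS2 (FG z z0) (GH z z0) => y /= -> ->.
Qed.

Canonical germ_equiv (n : nat) := EquivRelPack (@germ_eqv_equiv n).

Definition germ (n : nat) := {eq_quot (@germ_eqv n)}.
Definition germ_of (n : nat) (F : B R d n -> R) : germ n := \pi_(germ n) F.

Lemma germ_ofP (n : nat) (F G : B R d n -> R) :
  germ_of F = germ_of G <-> set_nbhs (B0 n) [set z | F z = G z].
Proof.
split=> [/eqquotP/asboolP //|FG].
by apply/eqquotP/asboolP.
Qed.

Definition in_Oloc (n : nat) (g : germ n) : Prop :=
  exists U F, Oloc_on U F /\ g = germ_of F.
Definition in_ODL (n : nat) (g : germ n) : Prop :=
  exists U F, ODL_on U F /\ g = germ_of F.

Definition Oloc (n : nat) : Type := {g : germ n | in_Oloc g}.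
Definition ODL (n : nat) : Type := {g : germ n | in_ODL g}.

Definition add_S0 (n : nat) (g : germ n) : germ n :=
  germ_of (S0 n \+ repr g).

Lemma add_S0E (n : nat) (F : B R d n -> R) :
  add_S0 (germ_of F) = germ_of (S0 n \+ F).
Proof.
apply/germ_ofP; have /germ_ofP : germ_of (repr (germ_of F)) = germ_of F.
  exact: reprK.
by move=> FG z /FG; apply: filterS => y /= ->.
Qed.

Lemma add_S0_subproof (n : nat) (f : Oloc n) : in_ODL (add_S0 (sval f)).
Proof.
case: f => _ /= [U [F [FU ->]]]; exists U, (S0 n \+ F).
by split; [exists F | exact: add_S0E].
Qed.

Definition ODL_of_Oloc (n : nat) (f : Oloc n) : ODL n :=
  exist _ (add_S0 (sval f)) (add_S0_subproof f).

Lemma Oloc0_subproof (n : nat) : in_Oloc (germ_of (fun=> 0 : R) : germ n).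
Proof. by exists setT, (fun=> 0); split; first exact: Oloc_on0. Qed.

Definition Oloc0 (n : nat) : Oloc n := exist _ _ (@Oloc0_subproof n).

Lemma ODL_S0_subproof (n : nat) : in_ODL (germ_of (S0 n) : germ n).
Proof.
exists setT, (S0 n); split=> //; exists (fun=> 0); first exact: Oloc_on0.
by move=> z _; rewrite addr0.
Qed.

Definition ODL_S0 (n : nat) : ODL n := exist _ _ (@ODL_S0_subproof n).

End Germs.

Arguments germ R d n : clear implicits.
Arguments Oloc R d n : clear implicits.
Arguments ODL R d n : clear implicits.
Arguments Oloc0 R d n : clear implicits.
Arguments ODL_S0 R d n : clear implicits.

Section Operad.

Definition composition (O : nat -> Type) : Type :=
  forall (n : nat) (k : 'I_n -> nat),
    O n -> (forall i, O (k i)) -> O (\sum_i k i)%N.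

(* The arities of the two sides of each axiom are equal but not convertible, so
   the equalities are between elements of the disjoint union of the O n.
   tagnat.sig1 s and tagnat.sig2 s are the indices i and j of the s-th element
   H_ij of the sequence H_11, ..., H_1k_1, ..., H_n1, ..., H_nk_n. *)
Definition is_operad (O : nat -> Type) (comp : composition O) (I : O 1%N)
    : Prop :=
  (forall (n : nat) (k : 'I_n -> nat) (l : forall i, 'I_(k i) -> nat)
      (F : O n) (G : forall i, O (k i)) (H : forall i j, O (l i j)),
    Tagged O (comp _ _ (comp _ _ F G)
                (fun s => H (tagnat.sig1 s) (tagnat.sig2 s)))
    = Tagged O (comp _ _ F (fun i => comp _ _ (G i) (H i)))) /\
  (forall (n : nat) (F : O n), Tagged O (comp n _ F (fun=> I)) = Tagged O F).

End Operad.

Section Composition.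
Context {R : realType} {d n : nat} {k : 'I_n -> nat}.
Implicit Types (F : B R d n -> R) (G : forall i, B R d (k i) -> R).
Implicit Types (UF : set (B R d n)) (UG : forall i, set (B R d (k i))).

Local Notation K := (\sum_i k i)%N.

Definition cup G (z : phase R d K n) : R :=
  \sum_i G i (submxcol z.1 i, col i z.2).

(* V is an open neighbourhood of B0 and w = (p_F, x_G) is a solution, over V, of
   the system E of equations, continuous and with value (0, (x, ..., x)) at
   (0, x) *)
Definition is_branch (E : B R d K -> phase R d n n -> Prop)
    (V : set (B R d K)) (w : B R d K -> phase R d n n) : Prop :=
  [/\ open V, B0 K `<=` V, forall z, V z -> {for z, continuous w},
      forall x, w (0, x) = (0, xdiag n x) & forall z, V z -> E z (w z)].

Definition unique_branch (E : B R d K -> phase R d n n -> Prop) : Prop :=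
  (exists V w, is_branch E V w) /\
  (forall V w V' w', is_branch E V w -> is_branch E V' w' ->
    set_nbhs (B0 K) [set z | w z = w' z]).

Definition in_domains UF UG (z : B R d K) (w : phase R d n n) : Prop :=
  (forall i, UG i (submxcol z.1 i, col i w.2)) /\ UF (w.1, z.2).

Definition implicit_eqs F UF G UG (z : B R d K) (w : phase R d n n) : Prop :=
  [/\ in_domains UF UG z w,
      w.1 = nabla_x (cup G) (z.1, w.2) & w.2 = nabla_p F (w.1, z.2)].

Definition phi F G (w : B R d K -> phase R d n n) (z : B R d K) : R :=
  cup G (z.1, (w z).2) + F ((w z).1, z.2) - pairing (w z).1 (w z).2.

Definition implicit_eqs_loc F UF G UG (z : B R d K) (w : phase R d n n)
    : Prop :=
  [/\ in_domains UF UG z w,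
      w.1 = (\matrix_i psum (submxcol z.1 i)) + nabla_x (cup G) (z.1, w.2)
    & w.2 = xdiag n z.2 + nabla_p F (w.1, z.2)].

Definition Hloc F G (w : B R d K -> phase R d n n) (z : B R d K) : R :=
  cup G (z.1, (w z).2) + F ((w z).1, z.2)
  - pairing (nabla_x (cup G) (z.1, (w z).2)) (nabla_p F ((w z).1, z.2)).

End Composition.

Section Lagrangians.
Context {R : realType} {d : nat}.

(* the manifold (T^*R^d)^n *)
Local Notation T n := (phase R d n n).

Definition lagr (n : nat) (U : set (B R d n)) (F : B R d n -> R)
    : set (T n * T 1) :=
  [set ((z.1, nabla_p F z), (nabla_x F z, z.2)) | z in U].

Definition rel_comp (M N P : Type) (L' : set (N * P)) (L : set (M * N))
    : set (M * P) :=
  [set mp | exists n, L (mp.1, n) /\ L' (n, mp.2)].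

Definition tensor (n : nat) (k : 'I_n -> nat)
    (L : forall i, set (T (k i) * T 1)) : set (T (\sum_i k i)%N * T n) :=
  [set w | forall i, L i ((submxcol w.1.1 i, submxrow w.1.2 i),
                          (row i w.2.1, col i w.2.2))].

(* the part of L_F that lies over B0 *)
Definition core (n : nat) : set (T n * T 1) :=
  [set ((0, xdiag n x), (0, x)) | x in setT].

Definition germ_eq_at (X : topologicalType) (A S S' : set X) : Prop :=
  exists2 W, set_nbhs A W & S `&` W = S' `&` W.

(* L = L_F(L_G1, ..., L_Gn) as germs: the composition is taken over
   sufficiently small domains UF', UG' i of F and G i *)
Definition is_lagr_comp (n : nat) (k : 'I_n -> nat)
    (L : set (T (\sum_i k i)%N * T 1))
    (F : B R d n -> R) (UF : set (B R d n))
    (G : forall i, B R d (k i) -> R) (UG : forall i, set (B R d (k i)))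
    : Prop :=
  exists (UF0 : set (B R d n)) (UG0 : forall i, set (B R d (k i))),
  [/\ set_nbhs (B0 n) UF0 /\ UF0 `<=` UF,
      forall i, set_nbhs (B0 (k i)) (UG0 i) /\ UG0 i `<=` UG i
    & forall (UF' : set (B R d n)) (UG' : forall i, set (B R d (k i))),
        set_nbhs (B0 n) UF' -> UF' `<=` UF0 ->
        (forall i, set_nbhs (B0 (k i)) (UG' i) /\ UG' i `<=` UG0 i) ->
        germ_eq_at (@core (\sum_i k i)%N) L
          (rel_comp (lagr UF' F) (tensor (fun i => lagr (UG' i) (G i))))].

End Lagrangians.

(* Main.v *)
From HB Require Import structures.
Require Import Defs.
From mathcomp Require Import all_boot all_order all_algebra generic_quotient.
From mathcomp Require Import boolp classical_sets functions reals.
From mathcomp Require Import topology tvs normedtype landau sequences derive.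
From mathcomp Require Import prodnormedzmodule interval_inference lra.

Set Implicit Arguments.
Unset Strict Implicit.
Unset Printing Implicit Defensive.

Import Order.TTheory GRing.Theory Num.Theory numFieldNormedType.Exports.

Local Open Scope classical_set_scope.
Local Open Scope ring_scope.

(** Eliminating x_G from the implicit system leaves one equation for p_F,
      p_F = Phi (z, p_F)   with
      Phi (z, p) = nabla_x (cup G) (z.1, nabla_p F (p, z.2)),
    where z = (p_G, x_F).  As every G_i vanishes on the zero section, so does
    its gradient in x; hence Phi (z, p) = 0 for all p as soon as p_G = 0.  Near
    the zero section Phi (z, .) is therefore a contraction, p_F exists and is
    locally unique, and it depends smoothly on z.  The smooth dependence is
    proved without inverting matrices: any directional derivative y of the fixed
    point solves an affine equation y = A y + b with |A| <= 1/2 whose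
    coefficients are as smooth as the fixed point itself, and the solutions of
    such equations inherit the regularity of their coefficients
    ([smooth_fixpoint_exists], [fixpoint_unique]).

    The implicit equations say that phi is the critical value, with respect to
    (p_F, x_G), of cup G + F - x_G p_F.  The derivatives of the solution
    therefore cancel in d phi ([derive_phi]), so that
      nabla_p phi = nabla_p (cup G) (p_G, x_G) and
      nabla_x phi = nabla_x F (p_F, x_F).
    These two formulas give both the normalisation of phi on the zero section
    ([ODL_on_phi]) and the identity L_phi = L_F (L_G1, ..., L_Gn).  For the
    latter, a point of the composition of relations comes from a solution of
    the implicit system, which a priori could be far from the branch under
    consideration; F is restricted to covectors smaller than the radius of
    uniqueness ([tame_dom]) to exclude this ([is_lagr_comp_phi]).

    By local uniqueness the germ of phi depends on the germs of F and the G_i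
    only ([germ_phi_eq]).  For associativity, the solutions of the two systems
    that define (F (G)) (H) also solve the systems that define F (G (H)), by the
    formulas for the gradients of phi; local uniqueness identifies the solutions
    and the two critical values are the same sum ([assoc_branch]).  The rest is
    bookkeeping of arities, whose index sets are enumerated lexicographically on
    both sides ([Rank_assoc]).

    Since G |-> S_0 + G is a bijection from O_loc to S_0 + O_loc, the structure
    on O_loc is obtained by transport.  Inserting F + S_0 and G_i + S_0 turns
    one implicit system into the other ([implicit_eqs_locE]) and phi into
    S_0 + H ([phi_Hloc]). *)

(** * Differentials *)

Section Differentials.
Context {R : realType} {V W : normedModType R}.

Lemma differentiable_bound (f : V -> W) x : differentiable f x ->
  forall e, 0 < e -> \forall h \near 0, `|f (h + x) - f x - 'd f x h| <= e * `|h|.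
Proof.
move=> df e e0; have := diff_locallyx df; set o := (X in forall h, _ = _ + X h).
move=> E; have /eqoP/(_ _ e0) : o =o_ (0 : V) id by rewrite /o; exact: littleo_eqo.
apply: filterS => h; rewrite E; set a := f x; set b := 'd f x h; set c := o h.
by rewrite -(addrA (a + b + c)) -opprD addrC addKr.
Qed.

(** The elementary epsilon criterion for the Frechet derivative.  It is the form
    in which the differentiability of a fixed point is established. *)
Lemma differentiable_of_bound (f : V -> W) (l : {linear V -> W}) x :
  continuous l ->
  (forall e, 0 < e -> \forall h \near 0, `|f (h + x) - f x - l h| <= e * `|h|) ->
  differentiable f x /\ 'd f x = l :> (V -> W).
Proof.
move=> cl H.
have E : f \o shift x = cst (f x) + l +o_ 0 id.
  apply/eqaddoP => e e0; apply: filterS (H e e0) => h /=.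
  by rewrite opprD addrA.
have dE : 'd f x = l :> (V -> W) by exact: diff_unique.
by split=> //; apply/diff_locallyP; rewrite dE.
Qed.

Lemma near_eq_differentiable (f g : V -> W) x :
  (\near x, f x = g x) -> differentiable f x -> differentiable g x.
Proof.
move=> fg df; have fgx : f x = g x by exact: nbhs_singleton fg.
suff [] : differentiable g x /\ 'd g x = 'd f x :> (V -> W) by [].
apply: differentiable_of_bound => [|e e0]; first exact: diff_continuous.
have fg0 : \forall h \near 0, f (h + x) = g (h + x).
  by move: fg; rewrite (near_shift 0) /=; apply: filterS => h; rewrite subr0.
by apply: filterS2 fg0 (differentiable_bound df e0) => h <-; rewrite -fgx.
Qed.

End Differentials.

(** * Finite-dimensional normed spaces *)

Section LinearMaps.
Context {R : realType}.
Variables V W : normedModType R.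

Definition scalel (w : W) (r : R) : W := r *: w.
Lemma scalel_linear w : linear (scalel w).
Proof. by move=> a x y; rewrite /scalel scalerDl scalerA. Qed.
HB.instance Definition _ w :=
  GRing.isLinear.Build R R W _ (scalel w) (scalel_linear w).
Lemma continuous_scalel w : continuous (scalel w).
Proof. by move=> x; apply: continuousZr_tmp; exact: cvg_id. Qed.

Definition inpl (v : V) : V * W := (v, 0).
Lemma inpl_linear : linear inpl.
Proof. by move=> a x y; apply: injective_projections; rewrite //= scaler0 addr0. Qed.
HB.instance Definition _ := GRing.isLinear.Build R V (V * W)%type _ inpl inpl_linear.
Lemma continuous_inpl : continuous inpl.
Proof. by move=> x; apply: cvg_pair; [exact: cvg_id | exact: cvg_cst]. Qed.

Definition inpr (w : W) : V * W := (0, w).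
Lemma inpr_linear : linear inpr.
Proof. by move=> a x y; apply: injective_projections; rewrite //= scaler0 addr0. Qed.
HB.instance Definition _ := GRing.isLinear.Build R W (V * W)%type _ inpr inpr_linear.
Lemma continuous_inpr : continuous inpr.
Proof. by move=> x; apply: cvg_pair; [exact: cvg_cst | exact: cvg_id]. Qed.

(** Finite dimension, in the form needed for chain rules: a basis whose coordinate
    functions are continuous. *)
Definition has_coords (X : normedModType R) : Prop :=
  exists (I : finType) (e : I -> X) (c : I -> {linear X -> R}),
    (forall i, continuous (c i)) /\ forall x, x = \sum_i c i x *: e i.

Lemma continuous_sum (T : topologicalType) (I : Type) (r : seq I) (h : I -> T -> W) x :
  (forall i, {for x, continuous (h i)}) ->
  {for x, continuous (fun t => \sum_(i <- r) h i t)}.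
Proof.
move=> ch; elim: r => [|i r IH].
  have -> : (fun t => \sum_(i <- [::]) h i t) = fun=> 0 :> W.
    by apply/funext => t; rewrite big_nil.
  exact: cst_continuous.
have -> : (fun t => \sum_(j <- i :: r) h j t) = h i \+ fun t => \sum_(j <- r) h j t.
  by apply/funext => t; rewrite big_cons.
apply: (@continuousD R W T (h i) _ x); [exact: ch | exact: IH].
Qed.

Lemma linear_continuous_coords (l : {linear V -> W}) :
  has_coords V -> continuous l.
Proof.
move=> [I [e [c [cc E]]]] x.
have -> : l = (fun y => \sum_i c i y *: l (e i)) :> (V -> W).
  apply/funext => y; rewrite [in LHS](E y) linear_sum.
  by apply: eq_bigr => i _; rewrite linearZ.
by apply: continuous_sum => i; apply: continuousZr_tmp; exact: cc.
Qed.

End LinearMaps.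
Arguments inpl {R V W}.
Arguments inpr {R V W}.

(* The Banach fixed point theorem is stated for complete normed modules. *)
HB.instance Definition _ (R : realType) (m n : nat) :=
  Uniform_isComplete.Build 'M[R]_(m, n) cauchy_cvg.

Section Coords.
Context {R : realType}.

Definition mxcoord m n (i : 'I_m) (j : 'I_n) (A : 'M[R]_(m, n)) : R := A i j.
Lemma mxcoord_linear m n i j : linear (@mxcoord m n i j).
Proof. by move=> a x y; rewrite /mxcoord !mxE. Qed.
HB.instance Definition _ m n i j :=
  GRing.isLinear.Build R 'M[R]_(m, n) R _ (@mxcoord m n i j) (@mxcoord_linear m n i j).

Lemma has_coords_mx m n : has_coords 'M[R]_(m, n).
Proof.
exists ('I_m * 'I_n)%type, (fun ij => delta_mx ij.1 ij.2), (fun ij => mxcoord ij.1 ij.2).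
split=> [ij|x]; first exact: coord_continuous.
by rewrite {1}[x]matrix_sum_delta pair_bigA.
Qed.

Lemma has_coords_prod (V W : normedModType R) :
  has_coords V -> has_coords W -> has_coords (V * W)%type.
Proof.
move=> [I [e [c [cc E]]]] [J [e' [c' [cc' E']]]].
pose b (k : I + J) : V * W := match k with inl i => (e i, 0) | inr j => (0, e' j) end.
pose l (k : I + J) : {linear (V * W)%type -> R} :=
  match k with inl i => (c i \o fst) | inr j => (c' j \o snd) end.
exists (I + J)%type, b, l; split=> [[i|j] x /=|[x y]].
- by apply: continuous_comp; [exact: cvg_fst | exact: cc].
- by apply: continuous_comp; [exact: cvg_snd | exact: cc'].
rewrite big_sumType /=.
transitivity (inpl x + inpr y : V * W).
  by apply: injective_projections; rewrite /= ?addr0 ?add0r.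
congr (_ + _).
  by rewrite [in LHS](E x) linear_sum; apply: eq_bigr => i _; rewrite linearZ.
by rewrite [in LHS](E' y) linear_sum; apply: eq_bigr => i _; rewrite linearZ.
Qed.

End Coords.

(** * Functions of class C^k *)

Section ChainRule.
Context {R : realType} {V W X : normedModType R}.

Lemma derive_linear (l : {linear W -> X}) (f : V -> W) z v :
  continuous l -> differentiable f z ->
  differentiable (fun t => l (f t)) z /\
  'D_v (fun t => l (f t)) z = l ('D_v f z).
Proof.
move=> cl df; have dl : differentiable l (f z) by exact: linear_differentiable.
have dc : differentiable (fun t => l (f t)) z by exact: (@differentiable_comp R V W X f l).
by rewrite !deriveE // (@diff_comp R V W X f l) //= diff_lin.
Qed.

Lemma derive_chain (g : W -> X) (f : V -> W) z v :
  differentiable f z -> differentiable g (f z) ->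
  differentiable (fun t => g (f t)) z /\
  'D_v (fun t => g (f t)) z = 'D_('D_v f z) g (f z).
Proof.
move=> df dg.
have dc : differentiable (fun t => g (f t)) z by exact: (@differentiable_comp R V W X f g).
by split=> //; rewrite !deriveE // (@diff_comp R V W X f g).
Qed.

End ChainRule.

Section ScaleRule.
Context {R : realType} {V W : normedModType R}.

Definition scale2 (a : R) (x : W) : W := a *: x.
Lemma scale_is_bilinear :
  bilinear_for
    (GRing.Scale.Law.clone _ _ *:%R _) (GRing.Scale.Law.clone _ _ *:%R _)
    scale2.
Proof.
rewrite /scale2; split=> [u'|u] a x y /=; first by rewrite scalerDl scalerA.
by rewrite scalerDr !scalerA mulrC.
Qed.
HB.instance Definition _ := bilinear_isBilinear.Build R R W W _ _
  scale2 scale_is_bilinear.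

Lemma derive_scale (a : V -> R) (f : V -> W) z v :
  differentiable a z -> differentiable f z ->
  differentiable (fun t => a t *: f t) z /\
  'D_v (fun t => a t *: f t) z = 'D_v a z *: f z + a z *: 'D_v f z.
Proof.
move=> da df.
pose s (p : R * W) := p.1 *: p.2; pose q t := (a t, f t).
have dq : differentiable q z by exact: differentiable_pair.
have cs : continuous s by exact: scale_continuous.
have ds : differentiable s (q z).
  exact: (@differentiable_bilin R R W W scale2).
have [dc E] := derive_chain v dq ds; split=> //; rewrite [LHS]E !deriveE //.
rewrite (@diff_bilin R R W W scale2) //.
by rewrite diff_pair //= addrC.
Qed.

Lemma derive_coords (f : V -> W) z (I : finType) (e : I -> V) (c : I -> V -> R) :
  differentiable f z -> (forall x, x = \sum_i c i x *: e i) ->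
  forall v, 'D_v f z = \sum_i c i v *: 'D_(e i) f z.
Proof.
move=> df E v; rewrite deriveE // {1}(E v) linear_sum.
by apply: eq_bigr => i _; rewrite linearZ deriveE.
Qed.

End ScaleRule.

Section Smoothness.
Context {R : realType}.
Section CkClosure.
Context {V W : normedModType R}.
Implicit Types (U : set V) (k : nat).

Lemma Ck_on_eq U k (f g : V -> W) : open U -> (forall z, U z -> f z = g z) ->
  Ck_on k U f -> Ck_on k U g.
Proof.
move=> oU; elim: k f g => [|k IH] f g fg /=.
  move=> cf z Uz; have nfg : \near z, f z = g z.
    by apply: filterS (open_nbhs_nbhs (conj oU Uz)) => y; exact: fg.
  rewrite /prop_for /continuous_at -(fg _ Uz).
  by apply: cvg_trans (cf z Uz); exact: near_eq_cvg.
have nfg z : U z -> \near z, f z = g z.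
  by move=> Uz; apply: filterS (open_nbhs_nbhs (conj oU Uz)) => y; exact: fg.
move=> [df Df]; split=> [z Uz|v]; first exact: near_eq_differentiable (nfg z Uz) (df z Uz).
by apply: IH (Df v) => z Uz; exact: near_eq_derive (nfg z Uz).
Qed.

Lemma Ck_onW U k (f : V -> W) : Ck_on k.+1 U f -> Ck_on k U f.
Proof.
elim: k f => [|k IH] f [df Df].
  by move=> z Uz; apply: differentiable_continuous; exact: df.
by split=> // v; apply: IH; exact: Df.
Qed.

Lemma Ck_onS U U' k (f : V -> W) : U' `<=` U -> Ck_on k U f -> Ck_on k U' f.
Proof.
move=> sU; elim: k f => [|k IH] f /=; first by move=> cf z /sU; exact: cf.
by move=> [df Df]; split=> [z /sU|v]; [exact: df | apply: IH].
Qed.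

Lemma Ck_onD U k (f g : V -> W) : open U ->
  Ck_on k U f -> Ck_on k U g -> Ck_on k U (fun z => f z + g z).
Proof.
move=> oU; elim: k f g => [|k IH] f g /=.
  by move=> cf cg z Uz; apply: (@continuousD R W V f g z); [exact: cf | exact: cg].
move=> [df Df] [dg Dg]; split=> [z Uz|v].
  by apply: (@differentiableD R V W f g z); [exact: df | exact: dg].
apply: Ck_on_eq oU _ (IH _ _ (Df v) (Dg v)) => z Uz.
by rewrite (@deriveD R V W f g z v) //; apply: diff_derivable; [exact: df | exact: dg].
Qed.

Lemma Ck_on_sum U k (I : Type) (r : seq I) (h : I -> V -> W) : open U ->
  (forall i, Ck_on k U (h i)) -> Ck_on k U (fun z => \sum_(i <- r) h i z).
Proof.
move=> oU ch; elim: r => [|i r IH].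
  by apply: Ck_on_eq oU _ (smooth_on_cst U (0 : W) k) => z _; rewrite big_nil.
by apply: Ck_on_eq oU _ (Ck_onD oU (ch i) IH) => z _; rewrite big_cons.
Qed.

End CkClosure.

Section CkScale.
Context {V W : normedModType R}.
Implicit Types (U : set V) (k : nat).

Lemma Ck_on_scale U k (a : V -> R) (f : V -> W) : open U ->
  Ck_on k U a -> Ck_on k U f -> Ck_on k U (fun z => a z *: f z).
Proof.
move=> oU; elim: k a f => [|k IH] a f /=.
  by move=> ca cf z Uz; apply: continuousZ; [exact: ca | exact: cf].
move=> [da Da] [df Df]; split=> [z Uz|v].
  by have [] := derive_scale 0 (da z Uz) (df z Uz).
have W1 : Ck_on k.+1 U a by []. have W2 : Ck_on k.+1 U f by [].
have := Ck_onD oU (IH _ _ (Da v) (Ck_onW W2)) (IH _ _ (Ck_onW W1) (Df v)).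
apply: Ck_on_eq => // z Uz; apply/esym.
by have [] := derive_scale v (da z Uz) (df z Uz).
Qed.

Lemma smooth_on_linear U (l : {linear V -> W}) : continuous l -> smooth_on U l.
Proof.
move=> cl [|k] /=; first by move=> z _; exact: cl.
have dl z : differentiable l z by exact: linear_differentiable.
split=> [z _ //|v]; have -> : (fun z => 'D_v l z) = fun=> l v.
  by apply/funext => z; rewrite deriveE // diff_lin.
exact: smooth_on_cst.
Qed.

End CkScale.

Section CkLinear.
Context {V W X : normedModType R}.
Implicit Types (U : set V) (k : nat).

Lemma Ck_on_linear U k (l : {linear W -> X}) (f : V -> W) : open U -> continuous l ->
  Ck_on k U f -> Ck_on k U (fun z => l (f z)).
Proof.
move=> oU cl; elim: k f => [|k IH] f /=.
  by move=> cf z Uz; apply: (@continuous_comp V W X f l); [exact: cf | exact: cl].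
move=> [df Df]; split=> [z Uz|v]; first by have [] := derive_linear 0 cl (df z Uz).
apply: Ck_on_eq oU _ (IH _ (Df v)) => z Uz.
by have [] := derive_linear v cl (df z Uz).
Qed.

End CkLinear.

Section CkCompose.
Context {V W X : normedModType R}.
Implicit Types (U : set V) (k : nat).

Lemma Ck_on_pair U k (f : V -> W) (g : V -> X) : open U ->
  Ck_on k U f -> Ck_on k U g -> Ck_on k U (fun z => (f z, g z)).
Proof.
move=> oU cf cg.
have cl := Ck_on_linear oU (@continuous_inpl R W X) cf.
have cr := Ck_on_linear oU (@continuous_inpr R W X) cg.
have := Ck_onD oU cl cr.
apply: Ck_on_eq => // z Uz.
by apply: injective_projections; rewrite /= ?addr0 ?add0r.
Qed.

(** Class C^k is defined by iterated derivatives in constant directions, whereas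
    the derivative of g o f is one of g in the variable direction D_v f.
    Expanding that direction in a basis expresses it by derivatives of g in
    constant directions, to which the induction hypothesis applies. *)
Lemma Ck_on_comp U (U' : set W) k (f : V -> W) (g : W -> X) :
  has_coords W -> open U -> open U' -> (forall z, U z -> U' (f z)) ->
  Ck_on k U f -> Ck_on k U' g -> Ck_on k U (fun z => g (f z)).
Proof.
move=> [I [e [c [cc E]]]] oU oU' fU; elim: k g => [|k IH] g /=.
  move=> cf cg z Uz; apply: (@continuous_comp V W X f g); first exact: cf.
  exact: cg (fU _ Uz).
move=> [df Df] [dg Dg]; split=> [z Uz|v].
  by have [] := derive_chain 0 (df z Uz) (dg _ (fU z Uz)).
have Cf : Ck_on k U f by apply: Ck_onW.
have H i : Ck_on k U (fun z => c i ('D_v f z) *: 'D_(e i) g (f z)).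
  exact: (Ck_on_scale oU (Ck_on_linear oU (cc i) (Df v)) (IH _ Cf (Dg (e i)))).
apply: Ck_on_eq oU _ (Ck_on_sum (index_enum I) oU H) => z Uz.
have [_ ->] := derive_chain v (df z Uz) (dg _ (fU z Uz)).
by rewrite [RHS](derive_coords (dg _ (fU z Uz)) E).
Qed.

End CkCompose.

Lemma Ck_on_mx (V : normedModType R) (U : set V) k m n (f : V -> 'M[R]_(m, n)) : open U ->
  (forall i j, Ck_on k U (fun z => f z i j)) -> Ck_on k U f.
Proof.
move=> oU cf.
have H (ij : 'I_m * 'I_n) : Ck_on k U (fun z => f z ij.1 ij.2 *: delta_mx ij.1 ij.2 : 'M[R]_(m, n)).
  by apply: Ck_on_scale => //; exact: smooth_on_cst.
apply: Ck_on_eq oU _ (Ck_on_sum (index_enum _) oU H) => z _ /=.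
by rewrite [RHS]matrix_sum_delta pair_bigA.
Qed.

End Smoothness.

(** * Regularity of fixed points *)

Section FixedPoints.
Context {R : realType}.

Lemma affine_fixpoint (F : completeNormedModType R) (f : F -> F) :
  (forall p q, `|f p - f q| <= 2^-1 * `|p - q|) -> exists p, p = f p.
Proof.
move=> H; have hf : {homo f : x / [set: F] x >-> [set: F] x} by [].
have h2 : (0 : R) <= 2^-1 by lra.
have ctr : is_contraction (mkfun_fun hf).
  exists (NngNum h2); split=> /=; first by lra.
  by move=> [p q] _; exact: H.
have [||p _ pE] := banach_fixed_point ctr; [exact: closedT | by exists 0 | by exists p].
Qed.

Lemma halving_eq0 (F : normedModType R) (x : F) : `|x| <= 2^-1 * `|x| -> x = 0.
Proof.
move=> H; have : `|x| <= 0 by have := normr_ge0 x; lra.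
by rewrite normr_le0 => /eqP.
Qed.

Section Derive.
Variables (E : normedModType R) (F : completeNormedModType R).
Hypothesis coordsE : has_coords E.

(** The candidate y v for the derivative is itself the fixed point of the
    contraction h |-> dPhi (v, h).  The remainder t = |w (h + z) - w z - y h|
    then satisfies t <= o (|h| + t) + t / 2, so it is o (|h|). *)
Lemma derive_fixpoint (Phi : E * F -> F) (w : E -> F) z :
  differentiable Phi (z, w z) -> {for z, continuous w} ->
  (\forall y \near z, w y = Phi (y, w y)) ->
  (forall h, `|'D_(0, h) Phi (z, w z)| <= 2^-1 * `|h|) ->
  differentiable w z /\ forall v, 'D_v w z = 'D_(v, 'D_v w z) Phi (z, w z).
Proof.
move=> dPhi cw wE contr.
pose L : {linear (E * F)%type -> F} := 'd Phi (z, w z).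
have DL v h : 'D_(v, h) Phi (z, w z) = L (v, h) by rewrite deriveE.
have {}contr h : `|L (0, h)| <= 2^-1 * `|h| by rewrite -DL.
have Lsplit v h : L (v, h) = L (v, 0) + L (0, h).
  by rewrite -linearD; congr (L _); apply: injective_projections; rewrite /= ?addr0 ?add0r.
have LB h h' : L (0, h) - L (0, h') = L (0, h - h').
  by rewrite -linearB; congr (L _); apply: injective_projections; rewrite /= ?subr0.
have exy v : exists y, y = L (v, y).
  apply: affine_fixpoint => p q.
  by rewrite (Lsplit v p) (Lsplit v q) opprD addrACA subrr add0r LB.
have [y yE] : exists y : E -> F, forall v, y v = L (v, y v).
  by exists (fun v => projT1 (cid (exy v))) => v; case: cid.
have ylin : linear y.
  move=> a u v; apply/eqP; rewrite -subr_eq0; apply/eqP/halving_eq0.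
  have {1}-> : y (a *: u + v) - (a *: y u + y v) =
      L (0, y (a *: u + v) - (a *: y u + y v)).
    rewrite {1}(yE (a *: u + v)) {1}(yE u) {1}(yE v) -linearP -linearB.
    by congr (L _); apply: injective_projections; rewrite //= subrr.
  exact: contr.
pose yL : {linear E -> F} := HB.pack y (GRing.isLinear.Build R E F _ y ylin).
have cy : continuous yL by exact: linear_continuous_coords.
suff dw : differentiable w z.
  split=> // v.
  pose q x := (x, w x).
  have dq : differentiable q z by apply: differentiable_pair => //; exact: ex_diff.
  have [_] := derive_chain v dq dPhi.
  have -> : 'D_v q z = (v, 'D_v w z).
    rewrite deriveE // diff_pair //.
    have -> : 'd id z = id :> (E -> E) by exact: diff_val.
    by rewrite [in RHS]deriveE //; exact: dw.
  by move=> <-; exact: near_eq_derive.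
have [C C0 yC] := linear_lipschitz cy.
(* e1 is small enough to absorb the contribution of t to the error (e1 <= 1/4)
   and to leave a remainder of at most e |h|. *)
suff : differentiable w z /\ 'd w z = yL :> (E -> F) by case.
apply: differentiable_of_bound => // e e0.
pose e1 := Num.min 4^-1 (e / (4 * (1 + C))).
have C1 : 0 < 4 * (1 + C) by lra.
have e10 : 0 < e1 by rewrite lt_min divr_gt0 // andbT; lra.
have e14 : e1 <= 4^-1 by rewrite ge_min lexx.
have e1C : e1 * (4 * (1 + C)) <= e by rewrite -ler_pdivlMr // ge_min lexx orbT.
pose d h : E * F := (h, w (h + z) - w z).
have cd2 : (w (h + z) - w z) @[h --> 0] --> (0 : F).
  rewrite -(subrr (w z)); apply: cvgB; last exact: cvg_cst.
  have cs : h + z @[h --> (0 : E)] --> 0 + z.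
    by apply: cvgD; [exact: cvg_id | exact: cvg_cst].
  by rewrite add0r in cs; apply: (@cvg_comp _ _ _ (fun h => h + z) w _ (nbhs z) _ cs); exact: cw.
have cd : d h @[h --> 0] --> (0 : E * F) by apply: cvg_pair cd2; exact: cvg_id.
have near_o : \forall h \near (0 : E),
    `|Phi (d h + (z, w z)) - Phi (z, w z) - L (d h)| <= e1 * `|d h|.
  exact: (cd _ (differentiable_bound dPhi e10)).
have wE0 : \forall h \near 0, w (h + z) = Phi (h + z, w (h + z)).
  by move: wE; rewrite (near_shift 0) /=; apply: filterS => h; rewrite subr0.
apply: filterS2 near_o wE0 => h; rewrite /d /= => H wh.
set D := w (h + z) - w z in H *.
have PhiE : Phi ((h, D) + (z, w z)) = w (h + z).
  by rewrite wh; congr Phi; apply: injective_projections; rewrite //= /D subrK.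
rewrite PhiE -(nbhs_singleton wE) -/D -/L in H.
have t2 : `|D - y h| <= e1 * `|(h, D)| + 2^-1 * `|D - y h|.
  apply: le_trans (lerD H (contr _)); apply: le_trans (ler_normD _ _).
  rewrite le_eqVlt; apply/orP; left; apply/eqP; congr `|_|.
  by rewrite -LB {1}(yE h) (Lsplit h D) (Lsplit h (y h)) !opprD !addrA addrNK.
have nD : `|D| <= `|D - y h| + C * `|h|.
  rewrite -[D in X in X <= _](subrK (y h)).
  by apply: le_trans (ler_normD _ _) _; rewrite lerD2l.
have nhD : `|(h, D)| <= `|h| + `|D|.
  by rewrite [leLHS]prod_normE /= ge_max lerDl lerDr !normr_ge0.
have h0 := normr_ge0 h; have t0 := normr_ge0 (D - y h).
set t := `|D - y h| in t2 nD t0 *; set a := `|h| in nD nhD h0 *.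
have m1 := ler_wpM2l (ltW e10) (le_trans nhD (lerD (lexx a) nD)).
have m2 := ler_wpM2r t0 e14; have m3 := ler_wpM2r h0 e1C.
rewrite -/t; nra.
Qed.

End Derive.

Section DeriveSum.
Context {V W : normedModType R}.

Lemma derive_add (f g : V -> W) z v : differentiable f z -> differentiable g z ->
  differentiable (fun t => f t + g t) z /\
  'D_v (fun t => f t + g t) z = 'D_v f z + 'D_v g z.
Proof.
move=> df dg; split; first exact: (@differentiableD R V W f g).
by rewrite (@deriveD R V W f g) //; exact: diff_derivable.
Qed.

Lemma derive_bigsum (I : Type) (r : seq I) (h : I -> V -> W) z v :
  (forall i, differentiable (h i) z) ->
  differentiable (fun t => \sum_(i <- r) h i t) z /\
  'D_v (fun t => \sum_(i <- r) h i t) z = \sum_(i <- r) 'D_v (h i) z.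
Proof.
move=> dh; elim: r => [|i r [dr Dr]].
  have -> : (fun t => \sum_(i <- [::]) h i t) = cst 0 :> (V -> W).
    by apply/funext => t; rewrite big_nil.
  by rewrite big_nil derive_cst; split; [exact: differentiable_cst|].
have -> : (fun t => \sum_(j <- i :: r) h j t) = fun t => h i t + \sum_(j <- r) h j t.
  by apply/funext => t; rewrite big_cons.
by rewrite big_cons -Dr; exact: derive_add.
Qed.

End DeriveSum.

Section Regularity.
Variables (E : normedModType R) (F : completeNormedModType R).
Hypothesis coordsE : has_coords E.
Variables (I : finType) (e : I -> F) (c : I -> {linear F -> R}).
Hypothesis cc : forall i, continuous (c i).
Hypothesis coordsF : forall x, x = \sum_i c i x *: e i.

Lemma Ck_on_continuous k (V : set E) (y : E -> F) z :
  Ck_on k V y -> V z -> {for z, continuous y}.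
Proof. by elim: k => [|k IH]; [exact | move=> /Ck_onW/IH]. Qed.

Lemma derive_affine (a : I -> E -> F) (b : E -> F) z p v h :
  (forall i, differentiable (a i) z) -> differentiable b z ->
  differentiable (fun q : E * F => \sum_i c i q.2 *: a i q.1 + b q.1) (z, p) /\
  'D_(v, h) (fun q : E * F => \sum_i c i q.2 *: a i q.1 + b q.1) (z, p) =
  \sum_i (c i h *: a i z + c i p *: 'D_v (a i) z) + 'D_v b z.
Proof.
move=> da db.
have d1 : differentiable (fst : E * F -> E) (z, p).
  by apply: linear_differentiable => x; exact: cvg_fst.
have D1 : 'D_(v, h) (fst : E * F -> E) (z, p) = v.
  by rewrite deriveE // diff_lin // => x; exact: cvg_fst.
have d2 : differentiable (snd : E * F -> F) (z, p).
  by apply: linear_differentiable => x; exact: cvg_snd.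
have D2 : 'D_(v, h) (snd : E * F -> F) (z, p) = h.
  by rewrite deriveE // diff_lin // => x; exact: cvg_snd.
have [dB DB] := derive_chain (v, h) d1 (db : differentiable b (fst (z, p))).
have H i := derive_chain (v, h) d1 (da i : differentiable (a i) (fst (z, p))).
have K i := derive_linear (v, h) (@cc i) d2.
have S i := derive_scale (v, h) (K i).1 (H i).1.
have [dS DS] := derive_bigsum (index_enum I) (v, h) (fun i => (S i).1).
have [dT DT] := derive_add (v, h) dS dB.
split=> //; rewrite [LHS]DT DS DB D1; congr (_ + _); apply: eq_bigr => i _.
by rewrite (S i).2 (H i).2 (K i).2 D1 D2.
Qed.

(** If y = A y + b, then D_v y = A (D_v y) + (D_v A) y + D_v b is an equation with
    the same contracting linear part and a new inhomogeneous term, which is of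
    class C^k by induction.  The linear part A z is given by its values a i z on
    a basis. *)
Lemma Ck_on_affine_fixpoint k (V : set E) (a : I -> E -> F) (b y : E -> F) :
  open V ->
  (forall z, V z -> y z = \sum_i c i (y z) *: a i z + b z) ->
  (forall z h, V z -> `|\sum_i c i h *: a i z| <= 2^-1 * `|h|) ->
  (forall i, Ck_on k V (a i)) -> Ck_on k V b -> Ck_on k V y.
Proof.
move=> oV + contr; elim: k b y => [|k IH] b y yE /= ca cb.
  move=> z Vz.
  pose r x := \sum_i c i (y z) *: a i x + b x - y z.
  have cS : {for z, continuous (fun x => \sum_i c i (y z) *: a i x)}.
    by apply: continuous_sum => i; apply: continuousZl_tmp; exact: ca.
  have cr : r x @[x --> z] --> 0.
    have -> : 0 = \sum_i c i (y z) *: a i z + b z - y z by rewrite -yE // subrr.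
    by apply: cvgB; [apply: cvgD; [exact: cS | exact: cb] | exact: cvg_cst].
  apply/cvgrPdist_le => eps eps0.
  have e2 : 0 < eps / 2 by lra.
  have nV : \forall x \near z, V x by exact: open_nbhs_nbhs.
  have /cvgrPdist_le/(_ _ e2) := cr; apply: filterS2 nV => x Vx.
  rewrite sub0r normrN => rx.
  have E1 : y x - y z = \sum_i c i (y x - y z) *: a i x + r x.
    rewrite {1}(yE x Vx) /r !addrA; congr (_ - _); congr (_ + _); rewrite -big_split /=.
    by apply: eq_bigr => i _; rewrite linearB -scalerDl subrK.
  have : `|y x - y z| <= 2^-1 * `|y x - y z| + eps / 2.
    rewrite {1}E1; apply: le_trans (ler_normD _ _) _.
    by apply: lerD => //; exact: contr.
  by rewrite distrC; lra.
have ya : Ck_on k V y.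
  apply: (IH b) => //; last by apply: Ck_onW; exact: cb.
  by move=> i; apply: Ck_onW; exact: ca.
have da z i : V z -> differentiable (a i) z by move=> Vz; apply: (ca i).1.
have db z : V z -> differentiable b z by move=> Vz; apply: cb.1.
pose Phi (q : E * F) := \sum_i c i q.2 *: a i q.1 + b q.1.
have DPhi z v h (Vz : V z) := derive_affine (y z) v h (da z ^~ Vz) (db z Vz).
have fix_ z : V z -> differentiable y z /\
    forall v, 'D_v y z = 'D_(v, 'D_v y z) Phi (z, y z).
  move=> Vz; apply: derive_fixpoint => //.
  - exact: (DPhi z 0 0 Vz).1.
  - exact: Ck_on_continuous ya Vz.
  - by apply: filterS (open_nbhs_nbhs (conj oV Vz)) => x; exact: yE.
  move=> h; rewrite (DPhi z 0 h Vz).2 derive0 addr0.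
  under eq_bigr do rewrite derive0 scaler0 addr0.
  exact: contr.
split=> [z Vz|v]; first by have [] := fix_ z Vz.
apply: (IH (fun z => \sum_i c i (y z) *: 'D_v (a i) z + 'D_v b z)).
- move=> z Vz; rewrite {1}(fix_ z Vz).2 (DPhi z v _ Vz).2 addrA; congr (_ + _).
  by rewrite -big_split.
- by move=> i; apply: Ck_onW; exact: ca.
apply: (Ck_onD oV) => /=; last exact: cb.2.
by apply: (Ck_on_sum _ oV) => i; apply: Ck_on_scale => //;
  [exact: Ck_on_linear | exact: (ca i).2].
Qed.

End Regularity.

Lemma deriveD_dir (V W : normedModType R) (f : V -> W) z u v :
  differentiable f z -> 'D_(u + v) f z = 'D_u f z + 'D_v f z.
Proof. by move=> df; rewrite !deriveE // linearD. Qed.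

Lemma derive_coords_r (E F W : normedModType R) (f : E * F -> W) q
    (I : finType) (e : I -> F) (c : I -> {linear F -> R}) h :
  (forall x, x = \sum_i c i x *: e i) -> differentiable f q ->
  'D_(0, h) f q = \sum_i c i h *: 'D_(0, e i) f q.
Proof.
move=> coordsF df; rewrite deriveE // {1}(coordsF h).
have -> : (0, \sum_i c i h *: e i) = \sum_i c i h *: (0, e i) :> E * F.
  rewrite -[LHS]/(inpr _) linear_sum; apply: eq_bigr => i _.
  by rewrite linearZ.
rewrite linear_sum; apply: eq_bigr => i _.
by rewrite linearZ -deriveE.
Qed.

(** Each D_v w solves the linearised equation, whose coefficients are derivatives
    of Phi along the graph of w, hence of the same class as w.  So w gains one
    derivative at each step of the induction. *)
Lemma smooth_on_fixpoint (E : normedModType R) (F : completeNormedModType R)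
    (U : set (E * F)) (V : set E) (Phi : E * F -> F) (w : E -> F) :
  has_coords E -> has_coords F -> open U -> open V -> smooth_on U Phi ->
  (forall z, V z -> U (z, w z)) -> (forall z, V z -> {for z, continuous w}) ->
  (forall z, V z -> w z = Phi (z, w z)) ->
  (forall z h, V z -> `|'D_(0, h) Phi (z, w z)| <= 2^-1 * `|h|) ->
  smooth_on V w.
Proof.
move=> coordsE coordsF oU oV sPhi VU cw wE contr.
have [I [e [c [cc cE]]]] := coordsF.
have dPhi z : V z -> differentiable Phi (z, w z) by move=> /VU; exact: (sPhi 1%N).1.
have fix_ z : V z -> differentiable w z /\
    forall v, 'D_v w z = 'D_(v, 'D_v w z) Phi (z, w z).
  move=> Vz; apply: derive_fixpoint => //; [exact: dPhi | exact: cw | | ].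
    by apply: filterS (open_nbhs_nbhs (conj oV Vz)) => x; exact: wE.
  by move=> h; exact: contr.
elim=> [|k IH] //; split=> [z Vz|v]; first exact: (fix_ z Vz).1.
have cg : Ck_on k V (fun z => (z, w z)).
  apply: Ck_on_pair => //.
  by apply: (@smooth_on_linear R E E V idfun _ k) => x; exact: cvg_id.
have cD u : Ck_on k V (fun z => 'D_u Phi (z, w z)).
  have [_ /(_ u) cDu] := sPhi k.+1.
  exact: (Ck_on_comp (has_coords_prod coordsE coordsF) oV oU VU cg cDu).
apply: (Ck_on_affine_fixpoint coordsE cc (a := fun i z => 'D_(0, e i) Phi (z, w z))
   (b := fun z => 'D_(v, 0) Phi (z, w z)) oV).
- move=> z Vz; rewrite {1}(fix_ z Vz).2 -(derive_coords_r _ cE) //; last exact: dPhi.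
  rewrite -deriveD_dir; last exact: dPhi.
  by congr ('D_ _ _ _); apply: injective_projections; rewrite /= ?addr0 ?add0r.
- by move=> z h Vz; rewrite -(derive_coords_r _ cE) //; [exact: contr | exact: dPhi].
- by move=> i; exact: cD.
- exact: cD.
Qed.

End FixedPoints.

(** * Existence and uniqueness of smooth fixed points *)

Section ImplicitFunctions.
Context {R : realType}.

Lemma mx_norm_le m n (A : 'M[R]_(m, n)) C : 0 <= C ->
  (forall i j, `|A i j| <= C) -> `|A| <= C.
Proof.
move=> C0 H; rewrite /Num.Def.normr /= mx_normrE.
by apply: bigmax_le => // -[i j] _; exact: H.
Qed.

Lemma derive_line (V W : normedModType R) (f : V -> W) x v (t : R) :
  differentiable f (x + t *: v) ->
  differentiable (fun s : R => f (x + s *: v)) t /\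
  'D_1 (fun s : R => f (x + s *: v)) t = 'D_v f (x + t *: v).
Proof.
move=> df.
have ds : differentiable (scalel v) t.
  by apply: linear_differentiable; exact: continuous_scalel.
have [dh Dh] := derive_add (1 : R) (differentiable_cst x t) ds.
have Eh : 'D_1 (fun s : R => x + scalel v s) t = v.
  rewrite [LHS]Dh derive_cst add0r deriveE // diff_lin; last exact: continuous_scalel.
  exact: scale1r.
by have := derive_chain (1 : R) dh df; rewrite Eh.
Qed.

(** The mean value inequality holds for matrix-valued functions with the sharp
    constant because the norm is the maximum of the entries. *)
Lemma mean_value_mx (V : normedModType R) m n (f : V -> 'M[R]_(m, n)) x v C :
  (forall t : R, 0 <= t <= 1 ->
     differentiable f (x + t *: v) /\ `|'D_v f (x + t *: v)| <= C) ->
  `|f (x + v) - f x| <= C.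
Proof.
move=> H; apply: mx_norm_le => [|i j].
  by have [|_] := H 0; [rewrite lexx ler01 | apply: le_trans].
pose g (t : R) : R := f (x + t *: v) i j.
have dg (t : R) : 0 <= t <= 1 -> differentiable g t /\ 'D_1 g t = ('D_v f (x + t *: v)) i j.
  move=> /H[df _]; have [dl Dl] := derive_line df.
  have cm : continuous (@mxcoord R m n i j) by exact: coord_continuous.
  by have := derive_linear (1 : R) cm dl; rewrite Dl.
have [| |c] := @MVT_segment R g (fun t => 'D_1 g t) 0 1 ler01.
- move=> t; rewrite in_itv /= => /andP[t0 t1]; apply: derivableP; apply: diff_derivable.
  by have [] := dg t; rewrite ?(ltW t0) ?(ltW t1).
- apply: derivable_within_continuous => t; rewrite in_itv /= => t01.
  by apply: diff_derivable; have [] := dg t t01.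
rewrite in_itv /= => c01; rewrite subr0 mulr1 (dg c c01).2 /g scale1r scale0r addr0.
rewrite !mxE => ->; have [_] := H c c01; apply: le_trans.
rewrite {2}/Num.Def.normr /= mx_normrE.
exact: (le_bigmax _ (fun ij => `|('D_v f (x + c *: v)) ij.1 ij.2|) (i, j)).
Qed.

Lemma cvg_slice (X Y Z : topologicalType) (f : X * Y -> Z) a p :
  {for (a, p), continuous f} -> f (z, p) @[z --> a] --> f (a, p).
Proof.
move=> cf; apply: (@cvg_comp _ _ _ (fun z => (z, p)) f _ (nbhs (a, p))); last exact: cf.
by apply: cvg_pair; [exact: cvg_id | exact: cvg_cst].
Qed.

Lemma nbhs_dist_lt (V : normedModType R) (a z : V) r :
  `|z - a| < r -> nbhs z [set x | `|x - a| < r].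
Proof.
move=> za; apply: open_nbhs_nbhs; split=> //.
rewrite (_ : [set x | _] = (fun x : V => `|x - a|) @^-1` [set s | s < r]) //.
apply: open_comp; last exact: open_lt.
by move=> x _; apply: cvg_norm; apply: cvgB; [exact: cvg_id | exact: cvg_cst].
Qed.

Section FixedPointFamily.
Variables (E : normedModType R) (m n : nat).
Local Notation F := 'M[R]_(m, n).
Variables (Phi : E * F -> F) (U : set (E * F)).
Hypotheses (coordsE : has_coords E) (oU : open U) (sPhi : smooth_on U Phi).

(** A radius around (a, 0) within which everything is uniform.  The derivative
    bound is listed beside the Lipschitz bound for later use in
    [smooth_on_fixpoint]. *)
Definition contracting_near (a : E) (eps : R) : Prop :=
  0 < eps /\ forall z p, `|z - a| < eps -> `|p| < eps ->
  [/\ U (z, p), forall h, `|'D_(0, h) Phi (z, p)| <= 2^-1 * `|h|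
    & forall p', `|p'| < eps -> `|Phi (z, p) - Phi (z, p')| <= 2^-1 * `|p - p'|].

(** Phi (a, .) is constant, so D_(0, h) Phi vanishes at (a, 0) and is small
    nearby by continuity. *)
Lemma contracting_near_exists a : U (a, 0) ->
  (forall p, U (a, p) -> Phi (a, p) = 0) -> exists eps, contracting_near a eps.
Proof.
move=> Ua Phi0; have [I [e [c [cc cE]]]] := has_coords_mx (R:=R) m n.
have dPhi q : U q -> differentiable Phi q by exact: (sPhi 1%N).1.
have D0 i : 'D_(0, e i) Phi (a, 0) = 0.
  have E0 : (a, 0) + 0 *: (0, e i) = (a, 0) :> E * F by rewrite scale0r addr0.
  have da : differentiable Phi ((a, 0) + (0 : R) *: (0, e i)).
    by rewrite E0; exact: dPhi.
  have [dl] := derive_line da.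
  rewrite E0 => <-; transitivity ('D_1 (cst (0 : F)) (0 : R)); last exact: derive_cst.
  apply: near_eq_derive.
  have cl : (a, 0) + s *: (0, e i) @[s --> (0 : R)] --> (a, 0 : F).
    rewrite -[X in _ --> X]E0; apply: cvgD; first exact: cvg_cst.
    by apply: cvgZr_tmp; exact: cvg_id.
  have : nbhs (0 : R) [set s | U ((a, 0) + s *: (0, e i))].
    by apply: (cl U); exact: open_nbhs_nbhs.
  apply: filterS => s /=.
  have -> : (a, 0) + s *: (0, e i) = (a, s *: e i) :> E * F.
    by apply: injective_projections; rewrite /= ?scaler0 ?addr0 ?add0r.
  exact: Phi0.
pose K i := projT1 (cid2 (linear_lipschitz (@cc i))).
have KP i : 0 < K i /\ forall h, `|c i h| <= K i * `|h| by rewrite /K; case: cid2.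
have K0 : 0 <= \sum_i K i by apply: sumr_ge0 => i _; apply: ltW; case: (KP i).
(* |D_(0, h) Phi| <= (\sum_i K i) * eta * |h| <= 1/2 |h|; the summand 1 only
   keeps eta well defined when the sum is 0. *)
pose eta := (2 * (\sum_i K i + 1))^-1.
have eta0 : 0 < eta by rewrite invr_gt0; lra.
have nD : \forall q \near (a, 0 : F), forall i, `|'D_(0, e i) Phi q| <= eta.
  suff Hi i : nbhs (a, 0 : F) [set q | `|'D_(0, e i) Phi q| <= eta].
    by apply: filterS (filter_forall _ Hi) => q.
  have cD : {for (a, 0 : F), continuous ('D_(0, e i) Phi)} by exact: (sPhi 1%N).2.
  move/cvgrPdist_le : cD => /(_ _ eta0); apply: filterS => q.
  by rewrite D0 sub0r normrN.
have nU : \forall q \near (a, 0 : F), U q by exact: open_nbhs_nbhs.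
have [eps /= eps0 Heps] := (nbhs_normP (a, 0 : F) _).1 (filterI nU nD).
have {Heps} P z p : `|z - a| < eps -> `|p| < eps ->
    U (z, p) /\ forall h, `|'D_(0, h) Phi (z, p)| <= 2^-1 * `|h|.
  move=> za pe; have [|Uz Dz] := Heps (z, p).
    by rewrite /= prod_normE /= gt_max distrC za sub0r normrN.
  split=> // h; rewrite (derive_coords_r h cE) //; last exact: dPhi.
  apply: le_trans (ler_norm_sum _ _ _) _.
  have HK : \sum_i `|c i h *: 'D_(0, e i) Phi (z, p)| <= \sum_i K i * `|h| * eta.
    apply: ler_sum => i _; rewrite normrZ; apply: ler_pM => //; first exact: (KP i).2.
  apply: le_trans HK _; rewrite -!mulr_suml -mulrA mulrC -mulrA mulrC.
  apply: ler_wpM2r; first exact: normr_ge0.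
  by rewrite /eta mulrC ler_pdivrMr; lra.
exists eps; split=> // z p za pe; have [Uz Dz] := P z p za pe; split=> // p' p'e.
have E1 : (z, p) = (z, p') + (0, p - p') :> E * F.
  by apply: injective_projections; rewrite /= ?addr0 // addrC subrK.
rewrite E1; apply: mean_value_mx => t /andP[t0 t1].
have -> : (z, p') + t *: (0, p - p') = (z, p' + t *: (p - p')) :> E * F.
  by apply: injective_projections; rewrite /= ?scaler0 ?addr0.
have [|Ut Dt] := P z (p' + t *: (p - p')) za; last by split; [exact: dPhi | exact: Dt].
have -> : p' + t *: (p - p') = (1 - t) *: p' + t *: p.
  by rewrite scalerBr scalerBl scale1r addrA addrAC.
apply: le_lt_trans (ler_normD _ _) _; rewrite !normrZ !ger0_norm; try lra.
set M := Num.max `|p| `|p'|.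
have ME : M < eps by rewrite gt_max pe p'e.
have pM : `|p| <= M by rewrite le_max lexx.
have p'M : `|p'| <= M by rewrite le_max lexx orbT.
have t1' : 0 <= 1 - t by lra.
by have := ler_wpM2l t0 pM; have := ler_wpM2l t1' p'M; lra.
Qed.

Lemma fixpoint_unique a eps z p p' : contracting_near a eps -> `|z - a| < eps ->
  `|p| < eps -> `|p'| < eps -> p = Phi (z, p) -> p' = Phi (z, p') -> p = p'.
Proof.
move=> [_ H] za pe p'e E1 E2; have [_ _ /(_ _ p'e)] := H _ _ za pe.
rewrite -E1 -E2 => /halving_eq0/eqP; by rewrite subr_eq0 => /eqP.
Qed.

(** The fixed points near the various points of A are glued by giving one formula
    for all of them: the limit of the iteration started at 0. *)
Lemma smooth_fixpoint_exists (A : set E) :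
  (forall a, A a -> U (a, 0)) -> (forall a p, A a -> U (a, p) -> Phi (a, p) = 0) ->
  exists V w, [/\ open V, A `<=` V, smooth_on V w, forall a, A a -> w a = 0
    & forall z, V z -> U (z, w z) /\ w z = Phi (z, w z)].
Proof.
move=> AU Phi0.
pose w z := limn (fun n => iter n (fun p => Phi (z, p)) 0).
have loc a : A a -> exists eps del, [/\ contracting_near a eps, 0 < del, del <= eps
    & forall z, `|z - a| < del -> `|w z| < eps /\ w z = Phi (z, w z)].
  move=> Aa; have [eps ce] := contracting_near_exists (AU a Aa) (Phi0 a ^~ Aa).
  have [eps0 H] := ce.
  have e4 : 0 < eps / 4 by lra.
  have cPhi : {for (a, 0 : F), continuous Phi} by exact: (sPhi 0%N _ (AU a Aa)).
  have c0 := cvg_slice cPhi; rewrite (Phi0 a 0 Aa (AU a Aa)) in c0.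
  have /cvgrPdist_lt/(_ _ e4)/nbhs_normP[del /= del0 Hd] := c0.
  exists eps, (Num.min del eps); split=> //; first by rewrite lt_min del0 eps0.
    by rewrite ge_min lexx orbT.
  move=> z; rewrite lt_min => /andP[zd ze].
  have {Hd} z4 : `|Phi (z, 0)| < eps / 4.
    by have := Hd z; rewrite /= distrC sub0r normrN; apply.
  pose B := [set p : F | `|p| <= eps / 2].
  have BB : {homo (fun p => Phi (z, p)) : p / B p >-> B p}.
    move=> p; rewrite /B /= => pB.
    have pe : `|p| < eps by lra.
    have [_ _ /(_ 0)] := H z p ze pe; rewrite normr0 subr0 => /(_ eps0) L.
    have := ler_normD (Phi (z, p) - Phi (z, 0)) (Phi (z, 0)); rewrite subrK; lra.
  have h2 : (0 : R) <= 2^-1 by lra.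
  have ctr : contraction (NngNum h2) (mkfun_fun BB).
    split=> /=; first by lra.
    move=> [p q] [/= pB qB].
    have pe : `|p| < eps by move: pB; rewrite /B /=; lra.
    by have [_ _ lip] := H z p ze pe; apply: lip; move: qB; rewrite /B /=; lra.
  have cB : closed B.
    rewrite (_ : B = (fun p : F => `|p|) @^-1` [set x | x <= eps / 2]) //.
    by apply: closed_comp; [move=> x _; exact: norm_continuous | exact: closed_le].
  have B0 : B 0 by rewrite /B /= normr0; lra.
  have wE := contraction_cvg_fixed ctr B0 cB.
  have wB : B (w z).
    apply: closed_cvg (contraction_cvg ctr B0) => //.
    by apply: nearW => k; elim: k => //= k; exact: BB.
  by split; [move: wB; rewrite /B /=; lra | exact: wE].
pose V := [set z | exists a eps del, [/\ A a, contracting_near a eps, 0 < del, del <= eps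
    & `|z - a| < del /\ forall x, `|x - a| < del -> `|w x| < eps /\ w x = Phi (x, w x)]].
have oV : open V.
  rewrite openE => z [a [eps [del [Aa ce del0 de [za H]]]]].
  apply: filterS (_ : nbhs z [set x | `|x - a| < del]) => [x xa|].
    by exists a, eps, del.
  exact: nbhs_dist_lt.
have VP z : V z -> [/\ U (z, w z), w z = Phi (z, w z), {for z, continuous w}
    & forall h, `|'D_(0, h) Phi (z, w z)| <= 2^-1 * `|h| ].
  move=> Vz; have [a [eps [del [Aa ce del0 de [za H]]]]] := Vz.
  have [wze wzE] := H z za; have ze : `|z - a| < eps by lra.
  have [Uz Dz _] := ce.2 z (w z) ze wze; split=> //.
  apply/cvgrPdist_le => eta eta0; have e2 : 0 < eta / 2 by lra.
  have cPhi : {for (z, w z), continuous Phi} by exact: (sPhi 0%N _ Uz).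
  have c0 := cvg_slice cPhi; rewrite -wzE in c0.
  have n1 := nbhs_dist_lt za.
  move/cvgrPdist_le : c0 => /(_ _ e2); apply: filterS2 n1 => x xa.
  have [wxe wxE] := H x xa; have xe : `|x - a| < eps by move: xa => /=; lra.
  have [_ _ /(_ _ wxe)] := ce.2 x (w z) xe wze; rewrite -wxE => h1 h2.
  have := ler_normD (w z - Phi (x, w z)) (Phi (x, w z) - w x).
  rewrite addrA subrK; lra.
exists V, w; split=> //.
- move=> a Aa; have [eps [del [ce del0 de H]]] := loc a Aa.
  by exists a, eps, del; split=> //; split=> //; rewrite subrr normr0.
- apply: (smooth_on_fixpoint coordsE (has_coords_mx m n) oU oV sPhi).
  + by move=> z /VP[].
  + by move=> z /VP[].
  + by move=> z /VP[].
  + by move=> z h /VP[].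
- move=> a Aa; have [eps [del [ce del0 de H]]] := loc a Aa.
  have a0 : `|a - a| < del by rewrite subrr normr0.
  have [wae waE] := H a a0.
  have eps0 : 0 < eps by lra.
  apply: (fixpoint_unique ce (_ : `|a - a| < eps) wae _ waE).
  + by rewrite subrr normr0.
  + by rewrite normr0.
  + by rewrite Phi0 //; exact: AU.
- by move=> z /VP[].
Qed.

End FixedPointFamily.
End ImplicitFunctions.

(** * Gradients on phase space *)

Section Gradients.
Context {R : realType} {d : nat}.

Lemma has_coords_phase m l : has_coords (phase R d m l).
Proof. by apply: has_coords_prod; exact: has_coords_mx. Qed.

Lemma pairingE m (p : 'M[R]_(m, d)) (x : 'M[R]_(d, m)) :
  pairing p x = \sum_i \sum_j p i j * x j i.
Proof. by rewrite /pairing /mxtrace; apply: eq_bigr => i _; rewrite mxE. Qed.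

Lemma pairingDl m (p q : 'M[R]_(m, d)) (x : 'M[R]_(d, m)) :
  pairing (p + q) x = pairing p x + pairing q x.
Proof. by rewrite /pairing mulmxDl mxtraceD. Qed.

Lemma pairingDr m (p : 'M[R]_(m, d)) (x y : 'M[R]_(d, m)) :
  pairing p (x + y) = pairing p x + pairing p y.
Proof. by rewrite /pairing mulmxDr mxtraceD. Qed.

Lemma pairing0l m (x : 'M[R]_(d, m)) : pairing 0 x = 0.
Proof. by rewrite /pairing mul0mx mxtrace0. Qed.

Lemma pairing0r m (p : 'M[R]_(m, d)) : pairing p 0 = 0.
Proof. by rewrite /pairing mulmx0 mxtrace0. Qed.

Lemma derive_p m l (f : phase R d m l -> R) z h : differentiable f z ->
  'D_(h, 0) f z = pairing h (nabla_p f z).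
Proof.
move=> df; rewrite deriveE // {1}[h]matrix_sum_delta pairingE.
have -> : (\sum_i \sum_j h i j *: delta_mx i j, 0) =
  \sum_i \sum_j h i j *: (delta_mx i j, 0) :> phase R d m l.
  rewrite -[LHS]/(inpl _) linear_sum; apply: eq_bigr => i _.
  by rewrite linear_sum; apply: eq_bigr => j _; rewrite linearZ.
rewrite linear_sum; apply: eq_bigr => i _; rewrite linear_sum; apply: eq_bigr => j _.
by rewrite linearZ -deriveE // mxE.
Qed.

Lemma derive_x m l (f : phase R d m l -> R) z h : differentiable f z ->
  'D_(0, h) f z = pairing (nabla_x f z) h.
Proof.
move=> df; rewrite deriveE // {1}[h]matrix_sum_delta pairingE [RHS]exchange_big /=.
have -> : (0, \sum_i \sum_j h i j *: delta_mx i j) =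
  \sum_i \sum_j h i j *: (0, delta_mx i j) :> phase R d m l.
  rewrite -[LHS]/(inpr _) linear_sum; apply: eq_bigr => i _.
  by rewrite linear_sum; apply: eq_bigr => j _; rewrite linearZ.
rewrite linear_sum; apply: eq_bigr => i _; rewrite linear_sum; apply: eq_bigr => j _.
by rewrite linearZ -deriveE // mxE mulrC.
Qed.

Lemma derive_phase m l (f : phase R d m l -> R) z v : differentiable f z ->
  'D_v f z = pairing v.1 (nabla_p f z) + pairing (nabla_x f z) v.2.
Proof.
move=> df; rewrite -derive_p // -derive_x // -deriveD_dir //.
by congr ('D_ _ _ _); case: v => p x; apply: injective_projections; rewrite /= ?addr0 ?add0r.
Qed.

Lemma pairing_deltal m i j (x : 'M[R]_(d, m)) : pairing (delta_mx i j) x = x j i.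
Proof.
rewrite pairingE (bigD1 i) //= [X in _ + X]big1 => [|a ai].
  rewrite addr0 (bigD1 j) //= big1 => [|b bj]; first by rewrite addr0 mxE !eqxx mul1r.
  by rewrite mxE (negbTE bj) andbF mul0r.
by apply: big1 => b _; rewrite mxE (negbTE ai) mul0r.
Qed.

Lemma pairing_deltar m i j (p : 'M[R]_(m, d)) : pairing p (delta_mx j i) = p i j.
Proof.
rewrite pairingE (bigD1 i) //= [X in _ + X]big1 => [|a ai].
  rewrite addr0 (bigD1 j) //= big1 => [|b bj]; first by rewrite addr0 mxE !eqxx mulr1.
  by rewrite mxE (negbTE bj) mulr0.
by apply: big1 => b _; rewrite mxE (negbTE ai) andbF mulr0.
Qed.

Lemma smooth_on_nabla_p m l (U : set (phase R d m l)) (f : phase R d m l -> R) :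
  open U -> smooth_on U f -> smooth_on U (nabla_p f).
Proof.
move=> oU sf k; apply: Ck_on_mx => // j i.
apply: Ck_on_eq oU _ ((sf k.+1).2 (delta_mx i j, 0)) => z _.
by rewrite mxE.
Qed.

Lemma smooth_on_nabla_x m l (U : set (phase R d m l)) (f : phase R d m l -> R) :
  open U -> smooth_on U f -> smooth_on U (nabla_x f).
Proof.
move=> oU sf k; apply: Ck_on_mx => // i j.
apply: Ck_on_eq oU _ ((sf k.+1).2 (0, delta_mx j i)) => z _.
by rewrite mxE.
Qed.

Lemma Ck_on_pairing (V : normedModType R) (U : set V) k m
    (p : V -> 'M[R]_(m, d)) (x : V -> 'M[R]_(d, m)) : open U ->
  Ck_on k U p -> Ck_on k U x -> Ck_on k U (fun z => pairing (p z) (x z)).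
Proof.
move=> oU cp cx.
have c a b i j : continuous (@mxcoord R a b i j) by exact: coord_continuous.
have H i : Ck_on k U (fun z => \sum_j p z i j * x z j i).
  apply: (Ck_on_sum _ oU) => j; apply: (Ck_on_scale oU).
    exact: (Ck_on_linear oU (c _ _ i j) cp).
  exact: (Ck_on_linear oU (c _ _ j i) cx).
by apply: Ck_on_eq oU _ (Ck_on_sum _ oU H) => z _; rewrite pairingE.
Qed.

Lemma derive_pairing (V : normedModType R) m
    (p : V -> 'M[R]_(m, d)) (x : V -> 'M[R]_(d, m)) z v :
  differentiable p z -> differentiable x z ->
  'D_v (fun z => pairing (p z) (x z)) z =
    pairing ('D_v p z) (x z) + pairing (p z) ('D_v x z).
Proof.
move=> dp dx.
have c a b i j : continuous (@mxcoord R a b i j) by exact: coord_continuous.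
have P i j := derive_linear v (c _ _ i j) dp.
have X i j := derive_linear v (c _ _ i j) dx.
have S i j := derive_scale v (P i j).1 (X j i).1.
have T i := derive_bigsum (index_enum _) v (fun j => (S i j).1).
have [_ D] := derive_bigsum (index_enum _) v (fun i => (T i).1).
have -> : (fun z => pairing (p z) (x z)) =
   fun z => \sum_i \sum_j mxcoord i j (p z) *: mxcoord j i (x z).
  by apply/funext => y; rewrite pairingE.
rewrite D !pairingE -big_split /=; apply: eq_bigr => i _.
rewrite (T i).2 -big_split /=; apply: eq_bigr => j _.
by rewrite (S i j).2 (P i j).2 (X j i).2.
Qed.

End Gradients.

(** * The germs S_0 + O_loc *)

Section Diagonal.
Context {R : realType} {d : nat}.

Lemma psum_linear n : linear (@psum R d n).
Proof.
move=> a p q; rewrite /psum scaler_sumr -big_split /=.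
by apply: eq_bigr => i _; rewrite linearP.
Qed.
HB.instance Definition _ n :=
  GRing.isLinear.Build R 'M[R]_(n, d) 'rV[R]_d _ (@psum R d n) (@psum_linear n).

Lemma S0_0 n x : @S0 R d n (0, x) = 0.
Proof. by rewrite /S0 (linear0 (@psum R d n)) pairing0l. Qed.

Lemma psum_delta n i j : psum (delta_mx i j : 'M[R]_(n, d)) = delta_mx 0 j.
Proof.
apply/rowP => b; rewrite /psum summxE (bigD1 i) //= big1 => [|a ai].
  by rewrite !mxE !eqxx addr0.
by rewrite !mxE (negbTE ai).
Qed.

Lemma derive_S0 n z v : differentiable (@S0 R d n) z /\
  'D_v (S0 n) z = pairing (psum v.1) z.2 + pairing (psum z.1) v.2 :> R.
Proof.
have cf : continuous (fst : B R d n -> _) by move=> x; exact: cvg_fst.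
have cs : continuous (snd : B R d n -> _) by move=> x; exact: cvg_snd.
have cp : continuous (@psum R d n).
  by apply: linear_continuous_coords; exact: has_coords_mx.
have df : differentiable (fst : B R d n -> _) z by exact: linear_differentiable.
have ds : differentiable (snd : B R d n -> _) z by exact: linear_differentiable.
have [dp Dp] := derive_linear v cp df.
split; last by rewrite [LHS]derive_pairing // Dp !deriveE // !diff_lin.
suff H : Ck_on 1 setT (@S0 R d n) by apply: H.1.
apply: Ck_on_pairing; first exact: openT.
  by apply: (Ck_on_linear openT cp); exact: smooth_on_linear.
exact: smooth_on_linear.
Qed.

Lemma smooth_on_S0 n (U : set (B R d n)) : open U -> smooth_on U (S0 n).
Proof.
move=> oU k.
have cf : continuous (fst : B R d n -> _) by move=> x; exact: cvg_fst.
have cs : continuous (snd : B R d n -> _) by move=> x; exact: cvg_snd.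
have cp : continuous (@psum R d n).
  by apply: linear_continuous_coords; exact: has_coords_mx.
apply: Ck_on_pairing => //; last exact: smooth_on_linear.
by apply: (Ck_on_linear oU cp); exact: smooth_on_linear.
Qed.

Lemma nabla_p_S0 n (z : B R d n) : nabla_p (S0 n) z = xdiag n z.2.
Proof.
apply/matrixP => j i; rewrite !mxE (derive_S0 z (delta_mx i j, 0)).2 /= pairing0r addr0.
by rewrite psum_delta pairing_deltal.
Qed.

Lemma nabla_x_S0 n (z : B R d n) : nabla_x (S0 n) z = psum z.1.
Proof.
apply/matrixP => i j; rewrite !mxE (derive_S0 z (0, delta_mx j i)).2 /= linear0 pairing0l add0r.
by rewrite pairing_deltar.
Qed.

Lemma nabla_p_eq m l (f g : phase R d m l -> R) z :
  (\near z, f z = g z) -> nabla_p f z = nabla_p g z.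
Proof. by move=> fg; apply/matrixP => j i; rewrite !mxE; exact: near_eq_derive. Qed.

Lemma nabla_x_eq m l (f g : phase R d m l -> R) z :
  (\near z, f z = g z) -> nabla_x f z = nabla_x g z.
Proof. by move=> fg; apply/matrixP => j i; rewrite !mxE; exact: near_eq_derive. Qed.

Lemma nabla_pD m l (f g : phase R d m l -> R) z : differentiable f z -> differentiable g z ->
  nabla_p (fun t => f t + g t) z = nabla_p f z + nabla_p g z.
Proof.
by move=> df dg; apply/matrixP => j i; rewrite !mxE (derive_add _ df dg).2.
Qed.

Lemma nabla_xD m l (f g : phase R d m l -> R) z : differentiable f z -> differentiable g z ->
  nabla_x (fun t => f t + g t) z = nabla_x f z + nabla_x g z.
Proof.
by move=> df dg; apply/matrixP => j i; rewrite !mxE (derive_add _ df dg).2.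
Qed.

Lemma smooth_on_differentiable (V W : normedModType R) (U : set V) (f : V -> W) z :
  smooth_on U f -> U z -> differentiable f z.
Proof. by move=> sf; apply: (sf 1%N).1. Qed.

Lemma smooth_on_continuous (V W : normedModType R) (U : set V) (f : V -> W) z :
  smooth_on U f -> U z -> {for z, continuous f}.
Proof. by move=> sf; apply: (sf 0%N). Qed.

Lemma smooth_on_eq (V W : normedModType R) (U : set V) (f g : V -> W) :
  open U -> (forall z, U z -> f z = g z) -> smooth_on U f -> smooth_on U g.
Proof. by move=> oU fg sf k; exact: Ck_on_eq oU fg (sf k). Qed.

Lemma smooth_onD (V W : normedModType R) (U : set V) (f g : V -> W) :
  open U -> smooth_on U f -> smooth_on U g -> smooth_on U (fun z => f z + g z).
Proof. by move=> oU sf sg k; exact: Ck_onD. Qed.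

Lemma smooth_onN (V W : normedModType R) (U : set V) (f : V -> W) :
  open U -> smooth_on U f -> smooth_on U (fun z => - f z).
Proof.
move=> oU sf k; apply: Ck_on_eq oU _ (Ck_on_scale oU (smooth_on_cst U (-1 : R) k) (sf k)).
by move=> z _; rewrite scaleN1r.
Qed.

Lemma smooth_onS (V W : normedModType R) (U U' : set V) (f : V -> W) :
  U' `<=` U -> smooth_on U f -> smooth_on U' f.
Proof. by move=> sU sf k; exact: Ck_onS (sf k). Qed.

Lemma near_open (T : topologicalType) (U : set T) (P : T -> Prop) z :
  open U -> U z -> (forall y, U y -> P y) -> \near z, P z.
Proof. by move=> oU Uz H; apply: filterS (open_nbhs_nbhs (conj oU Uz)). Qed.

(** The conditions on F - S_0 are conditions on F itself: F vanishes on the zero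
    section, where its gradient in p is the one of S_0. *)
Lemma ODL_onP n (U : set (B R d n)) (F : B R d n -> R) :
  ODL_on U F <-> [/\ open U, B0 n `<=` U, smooth_on U F,
    forall x, F (0, x) = 0 & forall x, nabla_p F (0, x) = xdiag n x].
Proof.
have S00 := @S0_0 n.
have B00 x : B0 n ((0, x) : B R d n) by [].
split.
  move=> [Ft [oU UB sFt Ft0 DFt0] FE].
  have sS := smooth_on_S0 oU; have UBx x := UB _ (B00 x); split=> //.
  - by apply: smooth_on_eq oU _ (smooth_onD oU sS sFt) => z Uz; rewrite FE.
  - by move=> x; rewrite FE // S00 Ft0 addr0.
  move=> x; rewrite -[RHS]addr0 -(DFt0 x) -(nabla_p_S0 (0, x)).
  rewrite -nabla_pD; try exact: smooth_on_differentiable (UBx x).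
  by apply: nabla_p_eq; exact: near_open oU (UBx x) FE.
move=> [oU UB sF F0 DF0]; have UBx x := UB _ (B00 x).
have sS := smooth_on_S0 oU; have sN := smooth_onN oU sS.
exists (fun z => F z - S0 n z); last by move=> z _; rewrite addrC subrK.
split=> //; first exact: smooth_onD.
  by move=> x; rewrite F0 S00 subrr.
move=> x; apply: (addrI (nabla_p (S0 n) (0, x))).
rewrite -nabla_pD; first last.
- by apply: smooth_on_differentiable (UBx x); exact: smooth_onD.
- exact: smooth_on_differentiable (UBx x).
have -> : (fun t => S0 n t + (F t - S0 n t)) = F.
  by apply/funext => t; rewrite addrC subrK.
by rewrite DF0 nabla_p_S0 addr0.
Qed.

Lemma derive_x_cst0 m l (f : phase R d m l -> R) y v :
  (forall x, f (0, x) = 0) -> 'D_(0, v) f (0, y) = 0.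
Proof.
move=> f0; rewrite /derive.
rewrite (_ : (fun h => _) = cst (0 : R)); first exact: lim_cst.
apply/funext => h /=.
have -> : h *: (0, v) + (0, y) = (0, h *: v + y) :> phase R d m l.
  by apply: injective_projections; rewrite /= ?scaler0 ?addr0.
by rewrite !f0 subrr scaler0.
Qed.

Lemma nabla_x_cst0 m l (f : phase R d m l -> R) y :
  (forall x, f (0, x) = 0) -> nabla_x f (0, y) = 0.
Proof. by move=> f0; apply/matrixP => i j; rewrite !mxE derive_x_cst0. Qed.

End Diagonal.

(** * The function G_1 \cup ... \cup G_n *)

Section Cup.
Context {R : realType} {d n : nat} {k : 'I_n -> nat}.
Local Notation K := (\sum_i k i)%N.

Definition block i (z : phase R d K n) : B R d (k i) := (submxcol z.1 i, col i z.2).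

Lemma block_linear i : linear (block i).
Proof.
by move=> a x y; apply: injective_projections; apply/matrixP => a' b'; rewrite !mxE.
Qed.
HB.instance Definition _ i :=
  GRing.isLinear.Build R (phase R d K n) (B R d (k i)) _ (block i) (block_linear i).

Lemma continuous_block i : continuous (block i).
Proof. by apply: linear_continuous_coords; exact: has_coords_phase. Qed.

Variables (G : forall i, B R d (k i) -> R) (UG : forall i, set (B R d (k i))).
Arguments G : clear implicits.
Arguments UG : clear implicits.
Hypotheses (oG : forall i, open (UG i)) (sG : forall i, smooth_on (UG i) (G i)).
Arguments oG : clear implicits.
Arguments sG : clear implicits.

Definition cup_dom : set (phase R d K n) := [set z | forall i, UG i (block i z)].

Lemma open_cup_dom : open cup_dom.
Proof.
rewrite openE => z Uz; suff H i : nbhs z [set y | UG i (block i y)].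
  by apply: filterS (filter_forall _ H).
have nU : nbhs (block i z) (UG i).
  by apply: open_nbhs_nbhs; split; [exact: oG | exact: Uz].
exact: (@continuous_block i z _ nU).
Qed.

Lemma smooth_on_cup : smooth_on cup_dom (cup G).
Proof.
move=> m; apply: (Ck_on_sum _ open_cup_dom) => i.
have H : forall z, cup_dom z -> UG i (block i z) by move=> z; apply.
have cb : Ck_on m cup_dom (block i) by apply: smooth_on_linear; exact: continuous_block.
exact: (Ck_on_comp (has_coords_phase _ _) open_cup_dom (oG i) H cb (sG i m)).
Qed.

Lemma derive_cup z v : cup_dom z ->
  'D_v (cup G) z = \sum_i 'D_(block i v) (G i) (block i z).
Proof.
move=> Uz.
have db i : differentiable (block i) z.
  by apply: linear_differentiable; exact: continuous_block.
have H i := derive_chain v (db i) (smooth_on_differentiable (sG i) (Uz i)).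
have [_ D] := derive_bigsum (index_enum _) v (fun i => (H i).1).
rewrite [LHS]D; apply: eq_bigr => i _; rewrite (H i).2.
suff -> : 'D_v (block i) z = block i v by [].
by rewrite deriveE // diff_lin //; exact: continuous_block.
Qed.

Lemma block_delta_x i i' j :
  block i' (0, delta_mx j i) = if i' == i then (0, delta_mx j 0) else 0.
Proof.
apply: injective_projections; case: eqVneq => [->|ii]; apply/matrixP => a b; rewrite !mxE //=.
  by rewrite eqxx [b]ord1 eqxx.
by rewrite (negbTE ii) andbF.
Qed.

Lemma block_delta_p i a j : block i (delta_mx (tagnat.Rank i a) j, 0) = (delta_mx a j, 0).
Proof.
apply: injective_projections; apply/matrixP => a' b; rewrite !mxE //=.
by rewrite -val_eqE /= tagnat.eq_Rank eqxx.
Qed.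

Lemma block_delta_p0 i i' a j : i' != i -> block i' (delta_mx (tagnat.Rank i a) j, 0) = 0.
Proof.
move=> ii; apply: injective_projections; apply/matrixP => a' b; rewrite !mxE //=.
by rewrite -val_eqE /= tagnat.eq_Rank (negbTE ii).
Qed.

Lemma row_nabla_x_cup z i : cup_dom z ->
  row i (nabla_x (cup G) z) = nabla_x (G i) (block i z).
Proof.
move=> Uz; apply/matrixP => o j; rewrite !mxE derive_cup // [LHS](bigD1 i) //=.
rewrite [X in _ + X]big1 => [|i' ii].
  by rewrite block_delta_x eqxx addr0 (ord1 o).
by rewrite block_delta_x (negbTE ii) derive0.
Qed.

Lemma submxrow_nabla_p_cup z i : cup_dom z ->
  submxrow (nabla_p (cup G) z) i = nabla_p (G i) (block i z).
Proof.
move=> Uz; apply/matrixP => j a; rewrite !mxE derive_cup // [LHS](bigD1 i) //=.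
rewrite [X in _ + X]big1 => [|i' ii].
  by rewrite block_delta_p addr0.
by rewrite block_delta_p0 // derive0.
Qed.

End Cup.

(** * The implicit system *)

Section SmoothMaps.
Context {R : realType}.

Lemma smooth_on_id (V : normedModType R) (U : set V) : smooth_on U (fun z => z).
Proof. by move=> k; apply: (@smooth_on_linear R V V U idfun) => x; exact: cvg_id. Qed.

Section Projections.
Context {V W X : normedModType R}.
Variables (U : set V) (f : V -> W * X).
Hypotheses (oU : open U) (sf : smooth_on U f).

Lemma smooth_on_fst : smooth_on U (fun z => (f z).1).
Proof.
by move=> k; apply: (@Ck_on_linear R V (W * X)%type W U k fst) => // x; exact: cvg_fst.
Qed.

Lemma smooth_on_snd : smooth_on U (fun z => (f z).2).
Proof.
by move=> k; apply: (@Ck_on_linear R V (W * X)%type X U k snd) => // x; exact: cvg_snd.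
Qed.

End Projections.

Lemma smooth_on_pair (V W X : normedModType R) (U : set V) (f : V -> W) (g : V -> X) :
  open U -> smooth_on U f -> smooth_on U g -> smooth_on U (fun z => (f z, g z)).
Proof. by move=> oU sf sg k; exact: Ck_on_pair. Qed.

Lemma smooth_on_comp (V W X : normedModType R) (U : set V) (U' : set W)
    (f : V -> W) (g : W -> X) :
  has_coords W -> open U -> open U' -> (forall z, U z -> U' (f z)) ->
  smooth_on U f -> smooth_on U' g -> smooth_on U (fun z => g (f z)).
Proof. by move=> hW oU oU' fU sf sg k; exact: (Ck_on_comp hW oU oU' fU). Qed.

Lemma cancel_cross (a b c e : R) : a + c + (e + b) + (- e - c) = a + b.
Proof. by lra. Qed.

Lemma derive_pair_fun (V W X : normedModType R) (f : V -> W) (g : V -> X) z v :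
  differentiable f z -> differentiable g z ->
  'D_v (fun t => (f t, g t)) z = ('D_v f z, 'D_v g z).
Proof.
by move=> df dg; rewrite !deriveE ?diff_pair //; exact: differentiable_pair.
Qed.

Lemma derive_fst (V W : normedModType R) (z v : V * W) : 'D_v fst z = v.1.
Proof.
have cf : continuous (fst : V * W -> V) by move=> x; exact: cvg_fst.
by rewrite deriveE ?diff_lin //; exact: linear_differentiable.
Qed.

Lemma derive_snd (V W : normedModType R) (z v : V * W) : 'D_v snd z = v.2.
Proof.
have cf : continuous (snd : V * W -> W) by move=> x; exact: cvg_snd.
by rewrite deriveE ?diff_lin //; exact: linear_differentiable.
Qed.

Lemma open_preimage_on (S T : topologicalType) (O : set S) (O' : set T) (f : S -> T) :
  open O -> open O' -> (forall z, O z -> {for z, continuous f}) ->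
  open [set z | O z /\ O' (f z)].
Proof.
move=> oO oO' cf; rewrite openE => z [Oz O'z].
have n1 : nbhs z O by exact: open_nbhs_nbhs.
have n2 : nbhs z (f @^-1` O') by apply: (cf z Oz); exact: open_nbhs_nbhs.
by apply: filterS2 n1 n2.
Qed.

Lemma set_nbhs_open (T : topologicalType) (A P : set T) :
  set_nbhs A P -> exists O, [/\ open O, A `<=` O & O `<=` P].
Proof.
move=> AP; exists P^°; split; [exact: open_interior | exact: AP | exact: interior_subset].
Qed.

End SmoothMaps.

Section Branches.
Context {R : realType} {d n : nat} {k : 'I_n -> nat}.
Local Notation K := (\sum_i k i)%N.

Lemma is_branchS (E : B R d K -> phase R d n n -> Prop) V w W :
  open W -> B0 K `<=` W -> W `<=` V -> is_branch E V w -> is_branch E W w.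
Proof.
move=> oW BW WV [oV BV cw w0 Ew].
by split; [exact: oW | exact: BW | move=> z /WV; exact: cw | exact: w0 | move=> z /WV; exact: Ew].
Qed.

Variables (F : B R d n -> R) (UF : set (B R d n)).
Variables (G : forall i, B R d (k i) -> R) (UG : forall i, set (B R d (k i))).
Arguments G : clear implicits.
Arguments UG : clear implicits.
Hypotheses (hF : ODL_on UF F) (hG : forall i, ODL_on (UG i) (G i)).
Arguments hG : clear implicits.

Let oUF : open UF. Proof. by move/ODL_onP: hF => []. Qed.
Let UFB : B0 n `<=` UF. Proof. by move/ODL_onP: hF => []. Qed.
Let sF : smooth_on UF F. Proof. by move/ODL_onP: hF => []. Qed.
Let F0 x : F (0, x) = 0. Proof. by move/ODL_onP: hF => []. Qed.
Let DF0 x : nabla_p F (0, x) = xdiag n x. Proof. by move/ODL_onP: hF => []. Qed.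
Let oUG i : open (UG i). Proof. by move/ODL_onP: (hG i) => []. Qed.
Let UGB i : B0 (k i) `<=` UG i. Proof. by move/ODL_onP: (hG i) => []. Qed.
Let sG i : smooth_on (UG i) (G i). Proof. by move/ODL_onP: (hG i) => []. Qed.
Let G0 i x : G i (0, x) = 0. Proof. by move/ODL_onP: (hG i) => []. Qed.
Let DG0 i x : nabla_p (G i) (0, x) = xdiag (k i) x.
Proof. by move/ODL_onP: (hG i) => []. Qed.

Local Notation UC := (cup_dom UG).
Let oUC : open UC := open_cup_dom oUG.
Let sC : smooth_on UC (cup G) := smooth_on_cup oUG sG.

Lemma cup_dom0 y : UC (0, y).
Proof. by move=> i; apply: UGB; rewrite /B0 /= submxcol0. Qed.

Lemma cup0 y : cup G (0, y) = 0.
Proof. by rewrite /cup big1 // => i _; rewrite /= submxcol0 G0. Qed.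

Definition elim_dom : set (B R d K * 'M[R]_(n, d)) :=
  [set q | UF (q.2, q.1.2) /\ UC (q.1.1, nabla_p F (q.2, q.1.2))].

(** The right hand side of the equation p_F = Phi (z, p_F) obtained by eliminating
    x_G; elim_dom is its natural domain. *)
Definition elim_map (q : B R d K * 'M[R]_(n, d)) : 'M[R]_(n, d) :=
  nabla_x (cup G) (q.1.1, nabla_p F (q.2, q.1.2)).

Lemma implicit_eqsP z w : implicit_eqs F UF G UG z w <->
  [/\ elim_dom (z, w.1), w.1 = elim_map (z, w.1) & w.2 = nabla_p F (w.1, z.2)].
Proof.
rewrite /elim_dom /elim_map /=; split.
  by case=> -[UGz UFz] E1 E2; rewrite -E2.
by case=> -[UFz UCz] E1 E2; split; rewrite // /in_domains E2.
Qed.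

Let UF1 : set (B R d K * 'M[R]_(n, d)) := [set q | UF (q.2, q.1.2)].

Let sproj : smooth_on [set: B R d K * 'M[R]_(n, d)] (fun q => (q.2, q.1.2)).
Proof.
have oT := @openT (B R d K * 'M[R]_(n, d))%type.
have sid := @smooth_on_id R (B R d K * 'M[R]_(n, d))%type setT.
apply: smooth_on_pair => //; first exact: smooth_on_snd.
exact: (smooth_on_snd oT (smooth_on_fst oT sid)).
Qed.

Let oUF1 : open UF1.
Proof.
rewrite (_ : UF1 = [set q | setT q /\ UF ((fun q => (q.2, q.1.2)) q)]).
  apply: (open_preimage_on openT oUF) => z Tz.
  exact: smooth_on_continuous sproj Tz.
by apply/seteqP; split=> q //= [].
Qed.

Let snab : smooth_on UF1 (fun q : B R d K * 'M[R]_(n, d) => nabla_p F (q.2, q.1.2)).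
Proof.
have hU : forall q, UF1 q -> UF (q.2, q.1.2) by [].
have sp := smooth_onS (@subsetT _ UF1) sproj.
have sN := smooth_on_nabla_p oUF sF.
exact: (smooth_on_comp (has_coords_phase _ _) oUF1 oUF hU sp sN).
Qed.

Let spair : smooth_on UF1 (fun q : B R d K * 'M[R]_(n, d) =>
  (q.1.1, nabla_p F (q.2, q.1.2))).
Proof.
apply: smooth_on_pair => //.
have sid := @smooth_on_id R (B R d K * 'M[R]_(n, d))%type UF1.
exact: (smooth_on_fst oUF1 (smooth_on_fst oUF1 sid)).
Qed.

Lemma open_elim_dom : open elim_dom.
Proof.
apply: (open_preimage_on oUF1 oUC) => z Uz.
exact: smooth_on_continuous spair Uz.
Qed.

Lemma smooth_on_elim_map : smooth_on elim_dom elim_map.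
Proof.
have H : forall q, elim_dom q -> UC (q.1.1, nabla_p F (q.2, q.1.2)) by move=> q [].
have sp : smooth_on elim_dom (fun q : B R d K * 'M[R]_(n, d) =>
    (q.1.1, nabla_p F (q.2, q.1.2))).
  by apply: smooth_onS spair => q [].
exact: (smooth_on_comp (has_coords_phase _ _) open_elim_dom oUC H sp
          (smooth_on_nabla_x oUC sC)).
Qed.

Lemma elim_dom0 x : elim_dom ((0, x), 0).
Proof. by split; [exact: UFB | exact: cup_dom0]. Qed.

Lemma elim_map0 x p : elim_map ((0, x), p) = 0.
Proof. by apply: nabla_x_cst0 => y; exact: cup0. Qed.

Let B0E z : B0 K z -> z = (0, z.2) :> B R d K.
Proof. by case: z => p x; rewrite /B0 /= => ->. Qed.

Lemma smooth_branch_exists : exists V w,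
  is_branch (implicit_eqs F UF G UG) V w /\ smooth_on V w.
Proof.
have [V [p [oV BV sp p0 pP]]] : exists V (p : B R d K -> 'M[R]_(n, d)),
    [/\ open V, B0 K `<=` V, smooth_on V p, forall a, B0 K a -> p a = 0
      & forall z, V z -> elim_dom (z, p z) /\ p z = elim_map (z, p z)].
  apply: (smooth_fixpoint_exists (has_coords_phase _ _) open_elim_dom smooth_on_elim_map).
    by move=> a /B0E ->; exact: elim_dom0.
  by move=> a q /B0E -> _; exact: elim_map0.
have Vsub : forall z, V z -> UF1 (z, p z) by move=> z /pP[[]].
have sq : smooth_on V (fun z => (z, p z)).
  by apply: smooth_on_pair => //; exact: smooth_on_id.
have sx := smooth_on_comp (has_coords_prod (has_coords_phase _ _) (has_coords_mx _ _))
  oV oUF1 Vsub sq snab.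
have sw : smooth_on V (fun z => (p z, nabla_p F (p z, z.2)) : phase R d n n).
  by apply: smooth_on_pair.
exists V, (fun z => (p z, nabla_p F (p z, z.2))); split; last exact: sw.
split; [exact: oV | exact: BV | | |].
- by move=> z Vz; exact: smooth_on_continuous sw Vz.
- by move=> x; rewrite p0 //= DF0.
by move=> z Vz; apply/implicit_eqsP; have [] := pP z Vz.
Qed.

(** Only p_F has to be small: it determines x_G. *)
Definition unique_within (x0 : 'cV[R]_d) (eps : R) : Prop :=
  0 < eps /\ forall z w w', `|z - (0, x0)| < eps -> `|w.1| < eps -> `|w'.1| < eps ->
    implicit_eqs F UF G UG z w -> implicit_eqs F UF G UG z w' -> w = w'.

Lemma unique_within_exists x0 : exists eps, unique_within x0 eps.
Proof.
have [eps ce] : exists eps, contracting_near elim_map elim_dom (0, x0) eps.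
  apply: (contracting_near_exists open_elim_dom smooth_on_elim_map (elim_dom0 x0)).
  by move=> p _; exact: elim_map0.
exists eps; split; first by case: ce.
move=> z w w' zx we w'e /implicit_eqsP[_ w1 w2] /implicit_eqsP[_ w'1 w'2].
have E1 : w.1 = w'.1 by exact: (fixpoint_unique ce zx we w'e w1 w'1).
by apply: injective_projections => //; rewrite w2 w'2 E1.
Qed.

Lemma branch_near V w x0 eps : is_branch (implicit_eqs F UF G UG) V w -> 0 < eps ->
  \forall z \near ((0, x0) : B R d K),
    [/\ V z, `|z - (0, x0)| < eps & `|(w z).1| < eps].
Proof.
move=> [oV BV cw w0 Ew] eps0.
have Vx : V (0, x0) by exact: BV.
have n1 : nbhs ((0, x0) : B R d K) V by exact: open_nbhs_nbhs.
have n2 : nbhs ((0, x0) : B R d K) [set z | `|z - (0, x0)| < eps].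
  by apply: nbhs_dist_lt; rewrite subrr normr0.
have c1 : (w z).1 @[z --> ((0, x0) : B R d K)] --> (0 : 'M[R]_(n, d)).
  have -> : 0 = (w (0, x0)).1 by rewrite w0.
  by apply: (cvg_comp w fst) (cw _ Vx) _; exact: cvg_fst.
have n3 : nbhs ((0, x0) : B R d K) [set z | `|(w z).1| < eps].
  move/cvgrPdist_lt : c1 => /(_ _ eps0); apply: filterS => z.
  by rewrite sub0r normrN.
by apply: filterS2 n1 (filterI n2 n3) => z Vz [].
Qed.

Lemma branch_unique V w V' w' :
  is_branch (implicit_eqs F UF G UG) V w -> is_branch (implicit_eqs F UF G UG) V' w' ->
  set_nbhs (B0 K) [set z | w z = w' z].
Proof.
move=> bw bw' z /B0E ->; set x0 := z.2.
have [eps [eps0 H]] := unique_within_exists x0.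
apply: filterS2 (branch_near x0 bw eps0) (branch_near x0 bw' eps0) => y [Vy ye wy] [V'y _ w'y].
have [_ _ _ _ Ew] := bw; have [_ _ _ _ Ew'] := bw'.
exact: (H y _ _ ye wy w'y (Ew y Vy) (Ew' y V'y)).
Qed.

(** A branch is only assumed to be continuous; near the zero section it agrees
    with the smooth branch. *)
Lemma branch_smooth V w : is_branch (implicit_eqs F UF G UG) V w ->
  exists W, [/\ W `<=` V, is_branch (implicit_eqs F UF G UG) W w & smooth_on W w].
Proof.
move=> bw; have [V1 [w1 [bw1 sw1]]] := smooth_branch_exists.
have [N [oO BO OE]] := set_nbhs_open (branch_unique bw bw1).
case: (bw) => oV BV _ _ _; case: (bw1) => oV1 BV1 _ _ _.
have oW : open (V `&` (V1 `&` N)) by apply: openI => //; exact: openI.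
exists (V `&` (V1 `&` N)); split; first by move=> z [].
  have BW : B0 K `<=` V `&` (V1 `&` N).
    by move=> z Bz; split; [exact: BV | split; [exact: BV1 | exact: BO]].
  by apply: (is_branchS oW BW _ bw) => z [].
apply: (smooth_on_eq oW (f := w1)); first by move=> z [_ [_ /OE]].
by apply: smooth_onS sw1 => z [_ []].
Qed.

(** * The generating function of the composition *)

Section Action.
Variables (V : set (B R d K)) (w : B R d K -> phase R d n n).
Hypotheses (bw : is_branch (implicit_eqs F UF G UG) V w) (sw : smooth_on V w).

Let oV : open V. Proof. by case: bw. Qed.

Lemma smooth_on_phi : smooth_on V (phi F G w).
Proof.
have [_ _ _ _ Ew] := bw; have sid := @smooth_on_id R (B R d K) V.
have s1 := smooth_on_fst oV sw; have s2 := smooth_on_snd oV sw.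
have sg := smooth_on_pair oV (smooth_on_fst oV sid) s2.
have sf := smooth_on_pair oV s1 (smooth_on_snd oV sid).
have hC : forall z, V z -> UC (z.1, (w z).2) by move=> z /Ew[[]].
have hUF : forall z, V z -> UF ((w z).1, z.2) by move=> z /Ew[[]].
have c1 := smooth_on_comp (has_coords_phase _ _) oV oUC hC sg sC.
have c2 := smooth_on_comp (has_coords_phase _ _) oV oUF hUF sf sF.
apply: (smooth_onD oV (smooth_onD oV c1 c2)); apply: smooth_onN => // m.
exact: Ck_on_pairing.
Qed.

(** The terms that contain the derivative of w = (p_F, x_G) cancel, because
    (p_F, x_G) is a critical point of cup G + F - x_G p_F. *)
Lemma derive_phi z v : V z ->
  differentiable (phi F G w) z /\
  'D_v (phi F G w) z = pairing v.1 (nabla_p (cup G) (z.1, (w z).2)) +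
                       pairing (nabla_x F ((w z).1, z.2)) v.2.
Proof.
move=> Vz; have [_ _ _ _ /(_ z Vz) [[UGz UFz] E1 E2]] := bw.
have sid := @smooth_on_id R (B R d K) V.
have s1 := smooth_on_fst oV sw; have s2 := smooth_on_snd oV sw.
have d1 := smooth_on_differentiable s1 Vz; have d2 := smooth_on_differentiable s2 Vz.
have sg := smooth_on_pair oV (smooth_on_fst oV sid) s2.
have sf := smooth_on_pair oV s1 (smooth_on_snd oV sid).
have dg := smooth_on_differentiable sg Vz; have df := smooth_on_differentiable sf Vz.
have dC : differentiable (cup G) (z.1, (w z).2) by exact: smooth_on_differentiable sC _.
have dF : differentiable F ((w z).1, z.2) by exact: smooth_on_differentiable sF _.
have Dg : 'D_v (fun z => (z.1, (w z).2) : phase R d K n) z = (v.1, 'D_v (fun z => (w z).2) z).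
  rewrite derive_pair_fun ?derive_fst //.
  exact: smooth_on_differentiable (smooth_on_fst oV sid) Vz.
have Df : 'D_v (fun z => ((w z).1, z.2) : phase R d n 1) z = ('D_v (fun z => (w z).1) z, v.2).
  rewrite derive_pair_fun ?derive_snd //.
  exact: smooth_on_differentiable (smooth_on_snd oV sid) Vz.
have [hC DC] := derive_chain v dg dC; have [hF' DF] := derive_chain v df dF.
have sphi : smooth_on V (phi F G w).
  exact: smooth_on_phi.
split; first exact: smooth_on_differentiable sphi Vz.
have dP : differentiable (fun z => pairing (w z).1 (w z).2) z.
  apply: (smooth_on_differentiable (U := V)) => // m.
  by apply: Ck_on_pairing.
have DP := derive_pairing v d1 d2.
have [hS DS] := derive_add v hC hF'.
have hN : differentiable (fun z => - pairing (w z).1 (w z).2) z.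
  exact: (@differentiableN R _ _ _ z).
have [_ ->] := derive_add v hS hN.
rewrite DS DC DF Dg Df (derive_phase _ dC) (derive_phase _ dF) /=.
rewrite (@deriveN R _ _ _ z v); last exact: diff_derivable.
rewrite DP -E1 -E2 opprD; set a := pairing v.1 _; set b := pairing _ v.2.
set c := pairing (w z).1 _; set e := pairing _ (w z).2.
exact: cancel_cross.
Qed.

Lemma nabla_p_phi z : V z -> nabla_p (phi F G w) z = nabla_p (cup G) (z.1, (w z).2).
Proof.
move=> Vz; apply/matrixP => j i; rewrite !mxE (derive_phi _ Vz).2 /= pairing0r addr0.
by rewrite pairing_deltal mxE.
Qed.

Lemma nabla_x_phi z : V z -> nabla_x (phi F G w) z = nabla_x F ((w z).1, z.2).
Proof.
move=> Vz; apply/matrixP => i j; rewrite !mxE (derive_phi _ Vz).2 /= pairing0l add0r.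
by rewrite pairing_deltar mxE.
Qed.

Lemma ODL_on_phi : ODL_on V (phi F G w).
Proof.
have [_ BV cw w0 Ew] := bw; apply/ODL_onP; split=> //.
- exact: smooth_on_phi.
- by move=> x; rewrite /phi w0 /= cup0 F0 pairing0l addr0 subr0.
move=> x; rewrite nabla_p_phi; last exact: BV.
rewrite w0 /=; apply/mxrowP => i; rewrite (submxrow_nabla_p_cup sG) //; last exact: cup_dom0.
rewrite /block /= submxcol0 DG0.
by apply/matrixP => a b; rewrite !mxE.
Qed.

(** * Composition of Lagrangian germs *)

Lemma unique_within_shift x0 x eps : unique_within x0 eps -> `|x - x0| < eps / 2 ->
  unique_within x (eps / 2).
Proof.
move=> [eps0 H] xx; split; first by lra.
move=> z u u' zx ue u'e; apply: H; try lra.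
have -> : z - (0, x0) = z - (0, x) + (0, x - x0) :> B R d K.
  by apply: injective_projections; rewrite /= ?subr0 ?addr0 // addrA subrK.
have n0 : `|(0 : 'M[R]_(K, d), x - x0)| = `|x - x0|.
  by rewrite prod_normE /= normr0 max_r.
by have := ler_normD (z - (0, x)) (0, x - x0); rewrite n0; lra.
Qed.

(** The domain to which F is shrunk in the composition of relations.  A point of
    the composition records p_G, x_F and two gradients but not p_F, so closeness
    to the core says nothing about p_F; membership of (p_F, x_F) in this domain
    puts p_F within the radius of uniqueness at x_F. *)
Definition tame_dom : set (B R d n) :=
  [set q | UF q /\ exists eps, unique_within q.2 eps /\ `|q.1| < eps].

Lemma set_nbhs_tame_dom : set_nbhs (B0 n) tame_dom.
Proof.
move=> [q x0]; rewrite /B0 /= => ->.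
have [eps ue] := unique_within_exists x0.
have [eps0 _] := ue; have e2 : 0 < eps / 2 by lra.
have n1 : nbhs ((0, x0) : B R d n) UF by apply: open_nbhs_nbhs; split=> //; exact: UFB.
have n2 : nbhs ((0, x0) : B R d n) [set q | `|q - (0, x0)| < eps / 2].
  by apply: nbhs_dist_lt; rewrite subrr normr0.
apply: filterS2 n1 n2 => -[p x] Upx; rewrite /= prod_normE /= subr0 gt_max => /andP[pe xe].
by split=> //; exists (eps / 2); split=> //; exact: unique_within_shift ue xe.
Qed.

(** Two radii of uniqueness compete: eps at x0, and the uncontrolled one at the
    nearby point z.2 provided by [tame_dom].  Uniqueness is applied with the larger one, around
    its own centre. *)
Lemma lagr_comp_near (UF' : set (B R d n)) (UG' : forall i, set (B R d (k i))) :
  set_nbhs (B0 n) UF' -> (forall i, set_nbhs (B0 (k i)) (UG' i)) ->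
  set_nbhs (B0 K) [set z | [/\ V z, UF' ((w z).1, z.2),
    forall i, UG' i (block i (z.1, (w z).2))
    & forall u, implicit_eqs F UF G UG z u -> tame_dom (u.1, z.2) -> u = w z]].
Proof.
move=> nF nG z /B0E ->; set x0 := z.2.
have [_ BV cw w0 Ew] := bw.
have V0 : V (0, x0) by exact: BV.
have [eps ue] := unique_within_exists x0; have [eps0 H] := ue.
have sid := @smooth_on_id R (B R d K) V.
have s1 := smooth_on_fst oV sw; have s2 := smooth_on_snd oV sw.
have sg := smooth_on_pair oV (smooth_on_fst oV sid) s2.
have sf := smooth_on_pair oV s1 (smooth_on_snd oV sid).
have n1 : \forall y \near ((0, x0) : B R d K), UF' ((w y).1, y.2).
  by apply: (smooth_on_continuous sf V0); rewrite w0; exact: nF.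
have n2 : \forall y \near ((0, x0) : B R d K), forall i, UG' i (block i (y.1, (w y).2)).
  suff Hi i : nbhs ((0, x0) : B R d K) [set y | UG' i (block i (y.1, (w y).2))].
    by apply: filterS (filter_forall _ Hi) => y Hy i; exact: (Hy i).
  apply: (smooth_on_continuous sg V0 (_ : nbhs _ (block i @^-1` (UG' i)))).
  apply: (@continuous_block R d n k i); apply: nG.
  by rewrite /B0 /= submxcol0.
apply: filterS3 n1 n2 (branch_near x0 bw eps0) => y UFy UGy [Vy ye we].
split=> // u Eu [_ [eta [[eta0 Heta] /= ueta]]].
have [le_e|lt_e] := leP eta eps.
  by apply: (H y) => //; [lra | exact: Ew].
apply: (Heta y) => //; last exact: Ew; last by lra.
have -> : y - (0, y.2) = (y.1, 0) :> B R d K.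
  by apply: injective_projections; rewrite /= ?subr0 ?subrr.
move: ye; rewrite !prod_normE /= normr0 subr0 gt_max => /andP[y1 _].
by rewrite gt_max (lt_trans y1 lt_e).
Qed.

Lemma is_lagr_comp_phi : is_lagr_comp (lagr V (phi F G w)) F UF G UG.
Proof.
exists tame_dom, UG; split.
- by split; [exact: set_nbhs_tame_dom | move=> q []].
- move=> i; split=> //; apply/set_nbhsP; exists (UG i).
  by split; [exact: oUG | exact: UGB |].
move=> UF' UG' nF sUF hUG'.
have nG i : set_nbhs (B0 (k i)) (UG' i) by have [] := hUG' i.
have sUG i : UG' i `<=` UG i by have [] := hUG' i.
have nN := lagr_comp_near nF nG; set N := (X in set_nbhs _ X) in nN.
have [_ BV cw w0 Ew] := bw.
exists [set m : phase R d K K * phase R d 1 1 | N (m.1.1, m.2.2)].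
  move=> _ [x _ <-].
  have cm : {for ((0, xdiag K x), (0, x)) : phase R d K K * phase R d 1 1,
      continuous (fun m : phase R d K K * phase R d 1 1 => (m.1.1, m.2.2) : B R d K)}.
    have sid := @smooth_on_id R (phase R d K K * phase R d 1 1)%type setT.
    have oT := @openT (phase R d K K * phase R d 1 1)%type.
    apply: (smooth_on_continuous (U := setT)) => //; apply: smooth_on_pair => //.
      exact: (smooth_on_fst oT (smooth_on_fst oT sid)).
    exact: (smooth_on_snd oT (smooth_on_snd oT sid)).
  by apply: cm; apply: nN.
apply/seteqP; split.
  move=> _ [[z Vz <-] Nz]; split=> //; have [/= _ UFz UGz _] := Nz.
  move: UFz UGz; rewrite -/z; case: z Vz Nz => pG xF Vz Nz /= UFz UGz.
  have [[UGw UFw] E1 E2] := Ew _ Vz.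
  exists (w (pG, xF)); split => [i /=|/=].
    exists (block i (pG, (w (pG, xF)).2)) => //=.
    rewrite nabla_p_phi // (submxrow_nabla_p_cup sG) //.
    by rewrite E1 (row_nabla_x_cup sG) -?E1.
  exists ((w (pG, xF)).1, xF) => //=.
  by rewrite nabla_x_phi //= -E2; case: (w _).
move=> [[pG xK] [p xF]] [[[pF xG] /= [tens [q UFq qE]]] Nz]; split=> //.
move: qE => [q1 q2 q3 q4]; case: q UFq q1 q2 q3 q4 => p' x' UFq /= ? xGE pE ?; subst p' x'.
have blk i : [/\ UG' i (block i (pG, xG)), nabla_p (G i) (block i (pG, xG)) = submxrow xK i
    & nabla_x (G i) (block i (pG, xG)) = row i pF].
  have [[p' x'] Ui [/= e1 e2 e3 e4]] := tens i.
  by rewrite /block /= -e1 -e4.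
have UCz : UC (pG, xG) by move=> i; apply: sUG; have [] := blk i.
have [/= Vz UFz UGz uniq_w] := Nz.
have Ez : implicit_eqs F UF G UG (pG, xF) (pF, xG).
  split=> //=; first by split=> //; have [] := sUF _ UFq.
  apply/row_matrixP => i; rewrite (row_nabla_x_cup sG) //.
  by have [_ _ ->] := blk i.
have wE := uniq_w _ Ez (sUF _ UFq).
exists (pG, xF) => //=; rewrite nabla_p_phi // nabla_x_phi // -wE /= pE.
congr (_, _, _); apply/mxrowP => i; rewrite (submxrow_nabla_p_cup sG) //.
by have [_ -> _] := blk i.
Qed.

End Action.
End Branches.

(** * Composition of germs *)

Section GermInvariance.
Context {R : realType} {d n : nat} {k : 'I_n -> nat}.
Local Notation K := (\sum_i k i)%N.
Implicit Types (F : B R d n -> R) (UF : set (B R d n)).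
Implicit Types (G : forall i, B R d (k i) -> R) (UG : forall i, set (B R d (k i))).

Lemma branch_theorem F UF G UG : ODL_on UF F -> (forall i, ODL_on (UG i) (G i)) ->
  unique_branch (implicit_eqs F UF G UG) /\
  (forall V w, is_branch (implicit_eqs F UF G UG) V w ->
    exists W, [/\ W `<=` V, ODL_on W (phi F G w) &
                  is_lagr_comp (lagr W (phi F G w)) F UF G UG]).
Proof.
move=> hF hG; split.
  have [V [w [bw _]]] := smooth_branch_exists hF hG.
  split; first by exists V, w.
  by move=> V1 w1 V2 w2 b1 b2; exact: branch_unique hF hG _ _ _ _ b1 b2.
move=> V w bw; have [W [WV bW sW]] := branch_smooth hF hG bw.
exists W; split=> //; first exact: ODL_on_phi hF hG _ _ bW sW.
exact: is_lagr_comp_phi hF hG _ _ bW sW.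
Qed.

Lemma branch_args_near (E : B R d K -> phase R d n n -> Prop) V w
    (OF : set (B R d n)) (OG : forall i, set (B R d (k i))) :
  is_branch E V w -> set_nbhs (B0 n) OF -> (forall i, set_nbhs (B0 (k i)) (OG i)) ->
  set_nbhs (B0 K) [set z | OF ((w z).1, z.2) /\
    forall i, OG i (block i (z.1, (w z).2))].
Proof.
move=> [oV BV cw w0 _] nF nG [p x0]; rewrite /B0 /= => ->.
have V0 : V (0, x0) by exact: BV.
have c1 : (w z).1 @[z --> ((0, x0) : B R d K)] --> (0 : 'M[R]_(n, d)).
  have -> : 0 = (w (0, x0)).1 by rewrite w0.
  exact: (cvg_comp w fst (cw _ V0) cvg_fst).
have c2 : (w z).2 @[z --> ((0, x0) : B R d K)] --> xdiag n x0.
  have -> : xdiag n x0 = (w (0, x0)).2 by rewrite w0.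
  exact: (cvg_comp w snd (cw _ V0) cvg_snd).
have n1 : \forall y \near ((0, x0) : B R d K), OF ((w y).1, y.2).
  have cF : ((w z).1, z.2) @[z --> ((0, x0) : B R d K)] --> ((0, x0) : B R d n).
    exact: (cvg_pair c1 cvg_snd).
  have nF0 : nbhs ((0, x0) : B R d n) OF by exact: nF.
  exact: (cF _ nF0).
have n2 : \forall y \near ((0, x0) : B R d K), forall i, OG i (block i (y.1, (w y).2)).
  suff Hi i : nbhs ((0, x0) : B R d K) [set y | OG i (block i (y.1, (w y).2))].
    by apply: filterS (filter_forall _ Hi) => y Hy i; exact: (Hy i).
  have cG : (z.1, (w z).2) @[z --> ((0, x0) : B R d K)] --> ((0, xdiag n x0) : phase R d K n).
    exact: (cvg_pair cvg_fst c2).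
  have nG0 : nbhs (block i (0, xdiag n x0)) (OG i).
    by apply: nG; rewrite /B0 /= submxcol0.
  exact: (cG _ (@continuous_block R d n k i _ _ nG0)).
by apply: filterS2 n1 n2 => y H1 H2.
Qed.

(** Near the zero section the implicit system only sees the germs: w takes values
    close to (0, (x, ..., x)), where the two sets of data have equal gradients. *)
Lemma branch_transfer F UF G UG F' UF' G' UG' V w :
  open UF' -> B0 n `<=` UF' -> (forall i, open (UG' i) /\ B0 (k i) `<=` UG' i) ->
  germ_of F = germ_of F' -> (forall i, germ_of (G i) = germ_of (G' i)) ->
  is_branch (implicit_eqs F UF G UG) V w ->
  exists W, [/\ W `<=` V, is_branch (implicit_eqs F' UF' G' UG') W w
    & forall z, W z -> phi F G w z = phi F' G' w z].
Proof.
move=> oUF' BUF' hUG' /germ_ofP FF' GG' bw.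
have [OF [oOF BOF OFE]] := set_nbhs_open FF'.
have exOG i : {OG | [/\ open OG, B0 (k i) `<=` OG & OG `<=` [set z | G i z = G' i z]]}.
  by apply: cid; apply: set_nbhs_open; apply/germ_ofP; exact: GG'.
pose OG i := sval (exOG i).
have OGP i : [/\ open (OG i), B0 (k i) `<=` OG i & OG i `<=` [set z | G i z = G' i z]].
  exact: svalP (exOG i).
have nF : set_nbhs (B0 n) (UF' `&` OF).
  apply/set_nbhsP; exists (UF' `&` OF); split=> //; first exact: openI.
  by move=> z Bz; split; [exact: BUF' | exact: BOF].
have nG i : set_nbhs (B0 (k i)) (UG' i `&` OG i).
  have [q1 b1] := hUG' i; have [q2 b2 _] := OGP i.
  apply/set_nbhsP; exists (UG' i `&` OG i); split=> //; first exact: openI.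
  by move=> z Bz; split; [exact: b1 | exact: b2].
have [N [oN BN NP]] := set_nbhs_open (branch_args_near bw nF nG).
case: (bw) => oV BV cw w0 Ew.
exists (V `&` N); split; first by move=> z [].
  split; [exact: openI | by move=> z Bz; split; [exact: BV | exact: BN] |
          by move=> z [/cw] | exact: w0 | ].
  move=> z [/Ew [_ E1 E2] /NP [[UFz OFz] UGz]]; split.
  - by split=> // i; have [] := UGz i.
  - rewrite E1; apply: nabla_x_eq.
    have oD : open (cup_dom OG) by apply: open_cup_dom => i; have [] := OGP i.
    apply: (near_open oD); first by move=> i; have [] := UGz i.
    move=> y Dy; rewrite /cup; apply: eq_bigr => i _.
    by have [_ _ H] := OGP i; exact: H (Dy i).
  rewrite {1}E2; apply: nabla_p_eq; exact: (near_open oOF OFz OFE).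
move=> z [_ /NP [[UFz OFz] UGz]]; rewrite /phi (OFE _ OFz); congr (_ + _ - _).
rewrite /cup; apply: eq_bigr => i _; have [_ _ H] := OGP i.
by apply: H; have [] := UGz i.
Qed.

Lemma germ_phi_eq F UF G UG F' UF' G' UG' V w V' w' :
  ODL_on UF' F' -> (forall i, ODL_on (UG' i) (G' i)) ->
  germ_of F = germ_of F' -> (forall i, germ_of (G i) = germ_of (G' i)) ->
  is_branch (implicit_eqs F UF G UG) V w ->
  is_branch (implicit_eqs F' UF' G' UG') V' w' ->
  germ_of (phi F G w) = germ_of (phi F' G' w').
Proof.
move=> hF' hG' FF' GG' bw bw'.
have [oUF BUF _ _ _] := (ODL_onP _ _).1 hF'.
have hUG i : open (UG' i) /\ B0 (k i) `<=` UG' i by have [] := (ODL_onP _ _).1 (hG' i).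
have [W [WV bW WE]] := branch_transfer oUF BUF hUG FF' GG' bw.
apply/germ_ofP; have uw := branch_unique hF' hG' bW bw'.
move=> z Bz; have := uw z Bz; case: bW => oW BW _ _ _.
apply: filterS2 (open_nbhs_nbhs (conj oW (BW z Bz))) => y Wy /= wE.
by rewrite WE // /phi wE.
Qed.

End GermInvariance.

Section Composition.
Context {R : realType} {d : nat}.

Lemma ODL_rep n (f : ODL R d n) : exists U F, ODL_on U F /\ sval f = germ_of F.
Proof. by case: f => g pg; exact: pg. Qed.

Lemma ODL_eq n (f g : ODL R d n) : sval f = sval g -> f = g.
Proof. by case: f g => f pf [g pg] /= E; subst g; congr exist; exact: Prop_irrelevance. Qed.

Lemma Oloc_eq n (f g : Oloc R d n) : sval f = sval g -> f = g.
Proof. by case: f g => f pf [g pg] /= E; subst g; congr exist; exact: Prop_irrelevance. Qed.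

Lemma ODL_reps (I : Type) (a : I -> nat) (g : forall i, ODL R d (a i)) :
  exists (UG : forall i, set (B R d (a i))) (G : forall i, B R d (a i) -> R),
  forall i, ODL_on (UG i) (G i) /\ sval (g i) = germ_of (G i).
Proof.
have [UG HUG] : exists UG : forall i, set (B R d (a i)),
    forall i, exists G, ODL_on (UG i) G /\ sval (g i) = germ_of G.
  by exists (fun i => projT1 (cid (ODL_rep (g i)))) => i; case: cid.
by exists UG, (fun i => projT1 (cid (HUG i))) => i; case: cid.
Qed.

Lemma comp_exists n (k : 'I_n -> nat) (f : ODL R d n) (g : forall i, ODL R d (k i)) :
  exists h : ODL R d (\sum_i k i)%N,
  forall F UF (G : forall i, B R d (k i) -> R) UG V w,
    ODL_on UF F -> (forall i, ODL_on (UG i) (G i)) ->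
    sval f = germ_of F -> (forall i, sval (g i) = germ_of (G i)) ->
    is_branch (implicit_eqs F UF G UG) V w ->
    sval h = germ_of (phi F G w).
Proof.
have [UF [F [hF fF]]] := ODL_rep f.
have [UG [G HG]] := ODL_reps g.
have hG i := (HG i).1; have gG i := (HG i).2.
have [V [w [bw sw]]] := smooth_branch_exists hF hG.
have ph : in_ODL (germ_of (phi F G w)).
  by exists V, (phi F G w); split=> //; exact: ODL_on_phi hF hG _ _ bw sw.
exists (exist _ _ ph) => F' UF' G' UG' V' w' hF' hG' fF' gG' bw' /=.
apply: germ_phi_eq hF' hG' _ _ bw bw'; first by rewrite -fF -fF'.
by move=> i; rewrite -gG -gG'.
Qed.

Definition ODL_comp : composition (ODL R d) :=
  fun n k f g => projT1 (cid (comp_exists f g)).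

Lemma ODL_compE n (k : 'I_n -> nat) (f : ODL R d n) (g : forall i, ODL R d (k i))
    F UF (G : forall i, B R d (k i) -> R) UG V w :
  ODL_on UF F -> (forall i, ODL_on (UG i) (G i)) ->
  sval f = germ_of F -> (forall i, sval (g i) = germ_of (G i)) ->
  is_branch (implicit_eqs F UF G UG) V w ->
  sval (ODL_comp f g) = germ_of (phi F G w).
Proof. by rewrite /ODL_comp; case: cid => h H; exact: H. Qed.

End Composition.

(** * Iterated blocks *)

Section BlockIndices.
Context {n : nat} {k : 'I_n -> nat}.
Local Notation K := (\sum_i k i)%N.

(** Statements about pairs (i, j) are proved through the elements s of the
    concatenation, since [sig1 s] and [sig2 s] reduce the types of the two sides
    of an equation to the same one, whereas [sig2 (Rank i j)] has a type that
    depends on an equation. *)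
Lemma tagnat_ind (P : forall i, 'I_(k i) -> Prop) :
  (forall s : 'I_K, P (tagnat.sig1 s) (tagnat.sig2 s)) -> forall i j, P i j.
Proof.
move=> H i j; have := H (tagnat.Rank i j).
by rewrite /tagnat.sig1 /tagnat.sig2 /tagnat.Rank tagnat.rankK.
Qed.

Lemma big_tagnat (T : Type) (idx : T) (op : Monoid.com_law idx)
    (Q : forall i, 'I_(k i) -> bool) (f : forall i, 'I_(k i) -> T) :
  \big[op/idx]_(s < K | Q (tagnat.sig1 s) (tagnat.sig2 s))
     f (tagnat.sig1 s) (tagnat.sig2 s) =
  \big[op/idx]_i \big[op/idx]_(j < k i | Q i j) f i j.
Proof.
rewrite sig_big_dep /= (reindex_onto tagnat.sig tagnat.rank) /=; last first.
  by move=> t _; exact: tagnat.rankK.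
by apply: eq_bigl => s; rewrite tagnat.sigK eqxx andbT.
Qed.

Variable l : forall i, 'I_(k i) -> nat.
Arguments l : clear implicits.
Local Notation L1 := (\sum_(s < K) l (tagnat.sig1 s) (tagnat.sig2 s))%N.
Local Notation L2 := (\sum_i \sum_(j < k i) l i j)%N.

Lemma sum_tagnat : L1 = L2.
Proof. exact: (@big_tagnat _ _ addn (fun _ _ => true)). Qed.

Lemma lt_tagnat (s s' : 'I_K) : (s' < s)%N =
  (tagnat.sig1 s' < tagnat.sig1 s)%N ||
  (tagnat.sig1 s' == tagnat.sig1 s) &&
    (nat_of_ord (tagnat.sig2 s') < nat_of_ord (tagnat.sig2 s))%N.
Proof.
have -> : (s' < s)%N = (s' < s)%O by [].
rewrite -tagnat.lt_sig Order.SigmaOrder.ltEsig /tagnat.sig1 /tagnat.sig2.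
case: (tagnat.sig s) (tagnat.sig s') => [i j] [i' j'] /=.
rewrite !Order.OrdinalOrder.leEord /= -val_eqE /=.
have [ii|ii|/val_inj ii] //= := ltngtP i' i.
by subst i'; rewrite tagged_asE.
Qed.

(** Both sides count the elements that precede the given one in the lexicographic
    order on triples (i, j, a). *)
Lemma Rank_assoc (s : 'I_K) (a : 'I_(l (tagnat.sig1 s) (tagnat.sig2 s))) :
  tagnat.Rank (p_ := fun s : 'I_K => l (tagnat.sig1 s) (tagnat.sig2 s)) s a =
  tagnat.Rank (p_ := fun i => \sum_j l i j)%N (tagnat.sig1 s)
    (tagnat.Rank (p_ := l (tagnat.sig1 s)) (tagnat.sig2 s) a) :> nat.
Proof.
rewrite !tagnat.RankEsum /= addnA; congr (_ + _)%N.
set i := tagnat.sig1 s; set j := tagnat.sig2 s.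
under eq_bigl do rewrite lt_tagnat.
rewrite (@big_tagnat _ _ addn (fun i' j' => (i' < i)%N || (i' == i) && (j' < j)%N)).
rewrite (bigID (fun i' : 'I_n => (i' < i)%N)) /=; congr (_ + _)%N.
  by apply: eq_bigr => i' ii; apply: eq_bigl => j'; rewrite ii.
rewrite (bigD1 i) ?ltnn //= [X in (_ + X)%N]big1 ?addn0 => [|i' /andP[ii' ne]].
  by apply: eq_bigl => j'; rewrite eqxx.
by rewrite big1 // => j'; rewrite (negbTE ii') (negbTE ne).
Qed.

End BlockIndices.

Section Casts.
Context {R : realType} {d : nat}.

Definition cast_arity m m' (e : m = m') (z : B R d m) : B R d m' :=
  (castmx (e, erefl d) z.1, z.2).

Lemma continuous_cast_arity m m' (e : m = m') : continuous (cast_arity e).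
Proof.
subst m'; have E : cast_arity erefl = id :> (B R d m -> B R d m).
  by apply/funext => -[p x]; rewrite /cast_arity castmx_id.
by rewrite E => z; exact: cvg_id.
Qed.

Lemma cast_arity0 m m' (e : m = m') x : cast_arity e (0, x) = (0, x).
Proof. by subst m'; rewrite /cast_arity castmx_id. Qed.

Lemma Tagged_ODL_eq m m' (e : m = m') (f : ODL R d m) (g : ODL R d m') F G :
  sval f = germ_of F -> sval g = germ_of G ->
  set_nbhs (B0 m') [set z | F (cast_arity (esym e) z) = G z] ->
  Tagged (ODL R d) f = Tagged (ODL R d) g.
Proof.
subst m' => fF gG FG; congr existT; apply: ODL_eq; rewrite fF gG; apply/germ_ofP.
move=> z /FG; apply: filterS => -[p x] /=.
by rewrite /cast_arity castmx_id.
Qed.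

Context {n : nat} {k : 'I_n -> nat}.
Local Notation K := (\sum_i k i)%N.

Lemma pairing_blocks (p : 'M[R]_(K, d)) (x : 'M[R]_(d, K)) :
  pairing p x = \sum_i pairing (submxcol p i) (submxrow x i).
Proof.
transitivity (\sum_i \sum_j \sum_b submxcol p i j b * submxrow x i b j); last first.
  by apply: eq_bigr => i _; rewrite pairingE.
rewrite -(@big_tagnat _ k _ 0 +%R (fun _ _ => true)
  (fun i j => \sum_b submxcol p i j b * submxrow x i b j)) pairingE.
by apply: eq_bigr => s _; apply: eq_bigr => b _; rewrite !mxE tagnat.sig2K.
Qed.

Lemma row_tagnat c (p : 'M[R]_(K, c)) s :
  row s p = row (tagnat.sig2 s) (submxcol p (tagnat.sig1 s)).
Proof. by apply/matrixP => a b; rewrite !mxE tagnat.sig2K. Qed.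

Lemma col_tagnat c (p : 'M[R]_(c, K)) s :
  col s p = col (tagnat.sig2 s) (submxrow p (tagnat.sig1 s)).
Proof. by apply/matrixP => a b; rewrite !mxE tagnat.sig2K. Qed.

Variable l : forall i, 'I_(k i) -> nat.
Arguments l : clear implicits.
Local Notation L1 := (\sum_(s < K) l (tagnat.sig1 s) (tagnat.sig2 s))%N.
Local Notation L2 := (\sum_i \sum_(j < k i) l i j)%N.

Lemma submxcol_cast (p : 'M[R]_(L2, d)) (s : 'I_K) :
  submxcol (castmx (esym (sum_tagnat l), erefl d) p) s =
  submxcol (submxcol p (tagnat.sig1 s)) (tagnat.sig2 s).
Proof.
apply/matrixP => a b; rewrite !mxE castmxE /= cast_ord_id; congr (p _ _).
by apply: val_inj; exact: Rank_assoc a.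
Qed.

Lemma cup_assoc (H : forall i j, B R d (l i j) -> R) (p : 'M[R]_(L2, d)) (y : 'M[R]_(d, K)) :
  cup (fun s : 'I_K => H (tagnat.sig1 s) (tagnat.sig2 s))
      (castmx (esym (sum_tagnat l), erefl d) p, y) =
  \sum_i cup (H i) (submxcol p i, submxrow y i).
Proof.
rewrite /cup /= -(@big_tagnat _ k _ 0 +%R (fun _ _ => true)
  (fun i j => H i j (submxcol (submxcol p i) j, col j (submxrow y i)))) /=.
by apply: eq_bigr => s _; rewrite submxcol_cast col_tagnat.
Qed.

End Casts.

(** * Associativity and unit *)

Section Associativity.
Context {R : realType} {d : nat}.

Lemma cancel_assoc (a b p f e : R) : a + b - p + f - e = a + (b + f - e) - p.
Proof. by lra. Qed.

Lemma continuous_fst_block n (k : 'I_n -> nat) i :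
  continuous (fun z : B R d (\sum_i k i)%N => submxcol z.1 i).
Proof.
pose j (z : B R d (\sum_i k i)%N) : phase R d (\sum_i k i)%N n := (z.1, 0).
have cj : continuous j.
  by move=> z; exact: (cvg_pair cvg_fst (cvg_cst (0 : 'M[R]_(d, n)))).
move=> z; have cb := continuous_comp (cj z) (@continuous_block R d n k i (j z)).
exact: (cvg_comp (fun z => block i (j z)) fst cb cvg_fst).
Qed.

(** A topological form of local uniqueness, suited to being pulled back along a
    continuous map. *)
Lemma branch_catch n (k : 'I_n -> nat) F UF (G : forall i, B R d (k i) -> R) UG V
    (w : B R d (\sum_i k i)%N -> phase R d n n) x0 :
  ODL_on UF F -> (forall i, ODL_on (UG i) (G i)) ->
  is_branch (implicit_eqs F UF G UG) V w ->
  \forall q \near (((0, x0), 0) : B R d (\sum_i k i)%N * 'M[R]_(n, d)),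
    V q.1 /\ forall u, u.1 = q.2 -> implicit_eqs F UF G UG q.1 u -> u = w q.1.
Proof.
move=> hF hG bw; have [eps [eps0 H]] := unique_within_exists hF hG x0.
have [_ _ _ _ Ew] := bw.
have n1 := branch_near x0 bw eps0.
have n2 : \forall p \near (0 : 'M[R]_(n, d)), `|p| < eps.
  have := @nbhs_dist_lt R _ (0 : 'M[R]_(n, d)) 0 eps; rewrite subr0 normr0 => /(_ eps0).
  by apply: filterS => p; rewrite /= subr0.
have n1' : \forall q \near (((0, x0), 0) : B R d (\sum_i k i)%N * 'M[R]_(n, d)),
    [/\ V q.1, `|q.1 - (0, x0)| < eps & `|(w q.1).1| < eps].
  exact: (@cvg_fst _ _ _ _ _ _ n1).
have n2' : \forall q \near (((0, x0), 0) : B R d (\sum_i k i)%N * 'M[R]_(n, d)),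
    `|q.2| < eps.
  exact: (@cvg_snd _ _ _ _ _ _ n2).
apply: filterS2 n1' n2' => -[z p] /= [Vz ze we] pe; split=> // u up Eu.
by apply: (H z) => //; [rewrite up | exact: Ew].
Qed.

Variables (n : nat) (k : 'I_n -> nat) (l : forall i, 'I_(k i) -> nat).
Arguments l : clear implicits.
Local Notation K := (\sum_i k i)%N.
Local Notation L1 := (\sum_(s < K) l (tagnat.sig1 s) (tagnat.sig2 s))%N.
Local Notation L2 := (\sum_i \sum_(j < k i) l i j)%N.
Variables (F : B R d n -> R) (UF : set (B R d n)).
Variables (G : forall i, B R d (k i) -> R) (UG : forall i, set (B R d (k i))).
Variables (H : forall i j, B R d (l i j) -> R) (UH : forall i j, set (B R d (l i j))).
Arguments G : clear implicits.
Arguments UG : clear implicits.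
Arguments H : clear implicits.
Arguments UH : clear implicits.
Hypotheses (hF : ODL_on UF F) (hG : forall i, ODL_on (UG i) (G i)).
Hypothesis hH : forall i j, ODL_on (UH i j) (H i j).
Arguments hG : clear implicits.
Arguments hH : clear implicits.

Variables (V1 : set (B R d K)) (w1 : B R d K -> phase R d n n).
Hypotheses (b1 : is_branch (implicit_eqs F UF G UG) V1 w1) (s1 : smooth_on V1 w1).

Let Hs (s : 'I_K) := H (tagnat.sig1 s) (tagnat.sig2 s).
Let UHs (s : 'I_K) := UH (tagnat.sig1 s) (tagnat.sig2 s).
Variables (V2 : set (B R d L1)) (w2 : B R d L1 -> phase R d K K).
Hypothesis b2 : is_branch (implicit_eqs (phi F G w1) V1 Hs UHs) V2 w2.

Variables (Vv : forall i, set (B R d (\sum_j l i j)%N)).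
Variables (v : forall i, B R d (\sum_j l i j)%N -> phase R d (k i) (k i)).
Arguments Vv : clear implicits.
Arguments v : clear implicits.
Hypothesis bv : forall i, is_branch (implicit_eqs (G i) (UG i) (H i) (UH i)) (Vv i) (v i).
Hypothesis sv : forall i, smooth_on (Vv i) (v i).
Arguments bv : clear implicits.
Arguments sv : clear implicits.

Local Notation psi := (fun i => phi (G i) (H i) (v i)).
Local Notation c := (cast_arity (esym (sum_tagnat l))).
Let u (z : B R d L2) : phase R d n n := w1 ((w2 (c z)).1, z.2).

(** The solution (p_G, x_H) of the system of (F (G)) (H), together with the solution
    (p_F, x_G) = u z of the inner system, solves the inner systems of F (G (H))
    block by block: nabla_p of the generating function of F (G) is
    nabla_p (cup G) (p_G, x_G). *)
Lemma nested_solution z : V2 (c z) ->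
  [/\ implicit_eqs F UF G UG ((w2 (c z)).1, z.2) (u z), V1 ((w2 (c z)).1, z.2)
    & forall i, implicit_eqs (G i) (UG i) (H i) (UH i) (block i (z.1, (u z).2))
        (submxcol (w2 (c z)).1 i, submxrow (w2 (c z)).2 i)].
Proof.
move=> V2z; have [_ _ _ _ Ew1] := b1; have [_ _ _ _ Ew2] := b2.
have [[UHz V1z] P1 P2] := Ew2 _ V2z.
have E1 : implicit_eqs F UF G UG ((w2 (c z)).1, z.2) (u z) by exact: Ew1.
split=> // i; have [[UGz UFz] Q1 Q2] := E1.
have sG i' : smooth_on (UG i') (G i') by have [] := (ODL_onP _ _).1 (hG i').
have sH i' j : smooth_on (UH i' j) (H i' j) by have [] := (ODL_onP _ _).1 (hH i' j).
set pG := (w2 (c z)).1 in P1 P2 E1 V1z UGz UFz Q1 Q2 *; set xH := (w2 (c z)).2 in UHz P1 P2 *.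
have UHb : forall i j, UH i j (submxcol (submxcol z.1 i) j, col j (submxrow xH i)).
  apply: tagnat_ind => s; have := UHz s; rewrite /UHs.
  by rewrite /cast_arity /= submxcol_cast col_tagnat.
have pGb : forall i j, row j (submxcol pG i) =
    nabla_x (H i j) (submxcol (submxcol z.1 i) j, col j (submxrow xH i)).
  apply: tagnat_ind => s; rewrite -row_tagnat -col_tagnat -submxcol_cast P1.
  by rewrite (row_nabla_x_cup (UG := UHs)) // => s'; exact: sH.
split.
- split=> [j|]; first exact: UHb.
  exact: UGz.
- by apply/row_matrixP => j; rewrite pGb (row_nabla_x_cup (UG := UH i)).
by rewrite /= P2 (nabla_p_phi hF hG b1 s1 V1z) (submxrow_nabla_p_cup sG).
Qed.

Lemma nested_continuous x0 :
  [/\ {for (0, x0), continuous (fun z : B R d L2 => ((w2 (c z)).1, z.2) : B R d K)},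
      {for (0, x0), continuous u}, u (0, x0) = (0, xdiag n x0)
    & (w2 (c (0, x0))).1 = 0].
Proof.
have [_ BV1 cw1 w10 _] := b1; have [_ BV2 cw2 w20 _] := b2.
have E2 : w2 (c (0, x0)) = (0, xdiag K x0) by rewrite cast_arity0 w20.
have Eu : u (0, x0) = (0, xdiag n x0) by rewrite /u E2 /= w10.
have cc : {for (0, x0), continuous (fun z : B R d L2 => w2 (c z))}.
  apply: continuous_comp; first exact: continuous_cast_arity.
  by apply: cw2; rewrite cast_arity0; exact: BV2.
have ca : {for (0, x0), continuous (fun z : B R d L2 => ((w2 (c z)).1, z.2) : B R d K)}.
  exact: (cvg_pair (cvg_comp (fun z => w2 (c z)) fst cc cvg_fst) cvg_snd).
split=> //; last by rewrite E2.
apply: (continuous_comp ca); apply: cw1; rewrite E2; exact: BV1.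
Qed.

(** By uniqueness the i-th block of (p_G, x_H) is the branch v i, evaluated at the
    i-th block of x_G = (u z).2.  Hence u solves the outer system of F (G (H)), and
    both critical values are
    cup H + cup G + F - x_H p_G - x_G p_F at the same point. *)
Lemma assoc_branch : exists W,
  is_branch (implicit_eqs F UF psi Vv) W u /\
  forall z, W z -> phi F psi u z = phi (phi F G w1) Hs w2 (c z).
Proof.
have [oV1 BV1 cw1 w10 Ew1] := b1; have [oV2 BV2 cw2 w20 Ew2] := b2.
pose q i (z : B R d L2) : B R d (\sum_j l i j)%N * 'M[R]_(k i, d) :=
  (block i (z.1, (u z).2), submxcol (w2 (c z)).1 i).
pose catch i (y : B R d (\sum_j l i j)%N * 'M[R]_(k i, d)) := Vv i y.1 /\
  forall t, t.1 = y.2 -> implicit_eqs (G i) (UG i) (H i) (UH i) y.1 t -> t = v i y.1.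
have nq : set_nbhs (B0 L2) [set z | V2 (c z) /\ forall i, catch i (q i z)].
  move=> [p x0]; rewrite /B0 /= => ->.
  have [ca cu Eu E2] := nested_continuous x0.
  have n1 : nbhs ((0, x0) : B R d L2) [set z | V2 (c z)].
    have nV2 : nbhs (c (0, x0)) V2.
      by apply: open_nbhs_nbhs; split=> //; rewrite cast_arity0; exact: BV2.
    exact: (@continuous_cast_arity R d _ _ _ _ _ nV2).
  suff n2 i : nbhs ((0, x0) : B R d L2) [set z | catch i (q i z)].
    by apply: filterS2 n1 (filter_forall _ n2) => z V2z Hz; split=> // i; exact: (Hz i).
  have Eq : q i (0, x0) = ((0, x0), 0).
    rewrite /q Eu E2 /block /= !submxcol0; congr (_, _, _).
    by apply/matrixP => a b; rewrite !mxE [b]ord1.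
  have cq : {for ((0, x0) : B R d L2), continuous (q i)}.
    have cb : {for ((0, x0) : B R d L2), continuous
        (fun z : B R d L2 => (z.1, (u z).2) : phase R d L2 n)}.
      exact: (cvg_pair cvg_fst (cvg_comp u snd cu cvg_snd)).
    have cb1 := continuous_comp cb (@continuous_block R d n (fun i => \sum_j l i j)%N i _).
    have ca1 := continuous_comp ca (@continuous_fst_block n k i _).
    exact: (cvg_pair cb1 ca1).
  by apply: cq; rewrite Eq; exact: (branch_catch x0 (hG i) (hH i) (bv i)).
have [W [oW BW WP]] := set_nbhs_open nq.
exists W.
have key z : W z -> [/\ implicit_eqs F UF G UG ((w2 (c z)).1, z.2) (u z),
    V1 ((w2 (c z)).1, z.2) & forall i, Vv i (block i (z.1, (u z).2)) /\
      v i (block i (z.1, (u z).2)) = (submxcol (w2 (c z)).1 i, submxrow (w2 (c z)).2 i)].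
  move=> /WP[V2z catchz]; have [E1 V1z Ei] := nested_solution V2z.
  by split=> // i; have [Viz uniq_v] := catchz i; split=> //; apply/esym/uniq_v.
split.
  split=> //.
  - move=> z Wz; have [V2z _] := WP z Wz; have [_ V1z _] := key z Wz.
    have cc : {for z, continuous (fun z : B R d L2 => w2 (c z))}.
      apply: continuous_comp; [exact: continuous_cast_arity | exact: cw2].
    have ca : {for z, continuous (fun z : B R d L2 => ((w2 (c z)).1, z.2) : B R d K)}.
      exact: (cvg_pair (cvg_comp (fun z => w2 (c z)) fst cc cvg_fst) cvg_snd).
    exact: (continuous_comp ca (cw1 _ V1z)).
  - by move=> x; have [_ _ ->] := nested_continuous x.
  move=> z Wz; have [[[UGz UFz] Q1 Q2] V1z Hv] := key z Wz.
  split; [split=> // i; exact: (Hv i).1 | | exact: Q2].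
  have hpsi i : ODL_on (Vv i) (psi i) by exact: ODL_on_phi (hG i) (hH i) _ _ (bv i) (sv i).
  have spsi i : smooth_on (Vv i) (psi i) by have [] := (ODL_onP _ _).1 (hpsi i).
  have sG i : smooth_on (UG i) (G i) by have [] := (ODL_onP _ _).1 (hG i).
  apply/row_matrixP => i.
  rewrite (row_nabla_x_cup spsi); last by move=> i'; exact: (Hv i').1.
  rewrite (nabla_x_phi (hG i) (hH i) (bv i) (sv i) (Hv i).1) (Hv i).2 /=.
  by rewrite Q1 (row_nabla_x_cup sG).
move=> z Wz; have [_ V1z Hv] := key z Wz.
rewrite /phi /= -/(u z).
have -> : cup psi (z.1, (u z).2) =
  \sum_i (cup (H i) (submxcol z.1 i, submxrow (w2 (c z)).2 i) +
     G i (submxcol (w2 (c z)).1 i, col i (u z).2) -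
     pairing (submxcol (w2 (c z)).1 i) (submxrow (w2 (c z)).2 i)).
  by apply: eq_bigr => i _; rewrite /phi -/(block i (z.1, (u z).2)) (Hv i).2.
rewrite sumrB big_split /= -pairing_blocks -(cup_assoc H).
exact: cancel_assoc.
Qed.

End Associativity.

Section OperadODL.
Context {R : realType} {d : nat}.

Lemma ODL_comp_assoc n (k : 'I_n -> nat) (l : forall i, 'I_(k i) -> nat)
    (f : ODL R d n) (g : forall i, ODL R d (k i)) (h : forall i j, ODL R d (l i j)) :
  Tagged (ODL R d) (ODL_comp (ODL_comp f g)
                     (fun s => h (tagnat.sig1 s) (tagnat.sig2 s)))
  = Tagged (ODL R d) (ODL_comp f (fun i => ODL_comp (g i) (h i))).
Proof.
have [UF [F [hF fF]]] := ODL_rep f.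
have [UG [G HG]] := ODL_reps g.
have hG i := (HG i).1; have gG i := (HG i).2.
have [UH0 [H0 HH0]] := ODL_reps (fun t : {i & 'I_(k i)} => h (tag t) (tagged t)).
pose UH i (j : 'I_(k i)) : set (B R d (l i j)) := UH0 (Tagged _ j).
pose H i (j : 'I_(k i)) : B R d (l i j) -> R := H0 (Tagged _ j).
have hH i (j : 'I_(k i)) : ODL_on (UH i j) (H i j) by exact: (HH0 (Tagged _ j)).1.
have gH i (j : 'I_(k i)) : sval (h i j) = germ_of (H i j) by exact: (HH0 (Tagged _ j)).2.
have [V1 [w1 [b1 s1]]] := smooth_branch_exists hF hG.
have hphi := ODL_on_phi hF hG b1 s1.
have hHs (s : 'I_(\sum_i k i)%N) := hH _ (tagnat.sig2 s).
have [V2 [w2 [b2 s2]]] := smooth_branch_exists hphi hHs.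
have exv i := smooth_branch_exists (hG i) (hH i).
have [Vv HVv] : exists Vv : forall i, set (B R d (\sum_j l i j)%N), forall i,
    exists v, is_branch (implicit_eqs (G i) (UG i) (H i) (UH i)) (Vv i) v /\ smooth_on (Vv i) v.
  by exists (fun i => projT1 (cid (exv i))) => i; case: cid.
have [v Hv] : exists v : forall i, B R d (\sum_j l i j)%N -> phase R d (k i) (k i), forall i,
    is_branch (implicit_eqs (G i) (UG i) (H i) (UH i)) (Vv i) (v i) /\ smooth_on (Vv i) (v i).
  by exists (fun i => projT1 (cid (HVv i))) => i; case: cid.
have bv i := (Hv i).1; have sv i := (Hv i).2.
have [W [bW WE]] := assoc_branch hF hG hH b1 s1 b2 bv sv.
have hpsi i := ODL_on_phi (hG i) (hH i) (bv i) (sv i).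
have E1 := ODL_compE hF hG fF gG b1.
have E2 := ODL_compE hphi hHs E1 (fun s => gH _ (tagnat.sig2 s)) b2.
have E3 i := ODL_compE (hG i) (hH i) (gG i) (gH i) (bv i).
have E4 := ODL_compE hF hpsi fF E3 bW.
apply: (Tagged_ODL_eq (e := sum_tagnat l) E2 E4) => z Bz.
have [oW BW _ _ _] := bW.
by apply: filterS (open_nbhs_nbhs (conj oW (BW z Bz))) => y /WE.
Qed.

Lemma pairing_rows n (p : 'M[R]_(n, d)) (x : 'M[R]_(d, n)) :
  pairing p x = \sum_i pairing (row i p) (col i x).
Proof.
rewrite pairingE; apply: eq_bigr => i _; rewrite pairingE big_ord1.
by apply: eq_bigr => j _; rewrite !mxE.
Qed.

Lemma sum_ones n : (\sum_(i < n) 1 = n)%N.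
Proof. by rewrite sum_nat_const card_ord muln1. Qed.

Lemma castK_arity m m' (e : m = m') (z : B R d m') :
  cast_arity e (cast_arity (esym e) z) = z.
Proof. by subst m'; case: z => p x; rewrite /cast_arity !castmx_id. Qed.

Lemma psum_ones n (p : 'M[R]_((\sum_(i < n) 1)%N, d)) i :
  psum (submxcol p i) = row i (castmx (sum_ones n, erefl d) p).
Proof.
rewrite /psum big_ord1; apply/rowP => b; rewrite !mxE castmxE /= cast_ord_id.
congr (p _ _); apply: val_inj.
transitivity (\sum_(j < n | (j < i)%N) 1 + 0)%N; first exact: tagnat.RankEsum.
by rewrite addn0 -(big_ord_widen n (fun=> 1%N)) ?sum_ones // ltnW.
Qed.

(** For G_i = I the system reads p_F = p_G and x_G = nabla_p F (p_F, x_F), and the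
    terms cup G and x_G p_F of phi cancel. *)
Lemma ODL_comp_unit n (f : ODL R d n) :
  Tagged (ODL R d) (ODL_comp f (fun _ : 'I_n => ODL_S0 R d 1)) = Tagged (ODL R d) f.
Proof.
have [UF [F [hF fF]]] := ODL_rep f.
have [oU BU sF F0 DF0] := (ODL_onP _ _).1 hF.
pose e := sum_ones n.
pose N := (\sum_(i < n) 1)%N.
pose w (z : B R d N) : phase R d n n :=
  ((cast_arity e z).1, nabla_p F (cast_arity e z)).
pose V := [set z : B R d N | UF (cast_arity e z)].
have hI (i : 'I_n) : ODL_on [set: B R d 1] (S0 1).
  by exists (fun=> 0); [exact: Oloc_on0 | move=> z _; rewrite addr0].
have sI (i : 'I_n) : smooth_on [set: B R d 1] (S0 1) by apply: smooth_on_S0; exact: openT.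
have oV : open V by apply: open_comp => // z _; exact: continuous_cast_arity.
have BV : B0 N `<=` V.
  by move=> [p x]; rewrite /B0 /= => ->; rewrite /V /= cast_arity0; exact: BU.
have cN z : V z -> {for z, continuous (fun y : B R d N => nabla_p F (cast_arity e y))}.
  move=> Vz; apply: continuous_comp; first exact: continuous_cast_arity.
  exact: smooth_on_continuous (smooth_on_nabla_p oU sF) Vz.
have bw : is_branch (implicit_eqs F UF (fun _ : 'I_n => S0 1) (fun=> setT)) V w.
  split; [exact: oV | exact: BV | | | ].
  - move=> z Vz.
    have c1 : {for z, continuous (fun y : B R d N => (cast_arity e y).1)}.
      exact: (cvg_comp (cast_arity e) fst (@continuous_cast_arity R d _ _ e z) cvg_fst).
    have c2 := cN z Vz.
    exact: (cvg_pair c1 c2).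
  - by move=> x; rewrite /w cast_arity0 DF0.
  move=> z Vz; split; [by [] | | by []].
  apply/row_matrixP => i; rewrite (row_nabla_x_cup sI) //.
  by rewrite nabla_x_S0 /= psum_ones.
have gI (i : 'I_n) : sval (ODL_S0 R d 1) = germ_of (S0 1) by [].
have E := ODL_compE hF hI fF gI bw.
apply: (Tagged_ODL_eq (e := e) E fF) => z _; apply: filterE => y /=.
rewrite -[in RHS](castK_arity e y); set t := cast_arity (esym e) y.
rewrite /phi; have -> : cup (fun _ : 'I_n => S0 1) (t.1, (w t).2) = pairing (w t).1 (w t).2.
  by rewrite pairing_rows; apply: eq_bigr => i _; rewrite /S0 /= psum_ones.
by rewrite addrAC subrr add0r.
Qed.

Lemma ODL_comp_operad : is_operad (@ODL_comp R d) (ODL_S0 R d 1).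
Proof. by split=> [n k l f g h|n f]; [exact: ODL_comp_assoc | exact: ODL_comp_unit]. Qed.

End OperadODL.

(** * The induced structure on O_loc *)

Section OperadOloc.
Context {R : realType} {d : nat}.

Lemma add_S0_inj n : injective (@add_S0 R d n).
Proof.
move=> g g'; have E h : h = germ_of (repr h) :> germ R d n by rewrite /germ_of reprK.
rewrite (E g) (E g') !add_S0E => /germ_ofP H; apply/germ_ofP => z /H.
by apply: filterS => y /= /addrI.
Qed.

Lemma ODL_of_Oloc_inj n : injective (@ODL_of_Oloc R d n).
Proof. by move=> f g /(congr1 sval)/= /add_S0_inj; exact: Oloc_eq. Qed.

Lemma ODL_of_Oloc_surj n (f : ODL R d n) : exists h, ODL_of_Oloc h = f.
Proof.
have [U [F [[Ft hFt FE] fF]]] := ODL_rep f.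
have ph : in_Oloc (germ_of Ft) by exists U, Ft.
exists (exist _ _ ph); apply: ODL_eq; rewrite /= add_S0E fF; apply/germ_ofP => z Bz.
have [oU BU _ _ _] := hFt.
by apply: filterS (open_nbhs_nbhs (conj oU (BU z Bz))) => y /FE.
Qed.

Definition Oloc_of_ODL n (f : ODL R d n) : Oloc R d n := projT1 (cid (ODL_of_Oloc_surj f)).

Lemma Oloc_of_ODLK n : cancel (@Oloc_of_ODL n) (@ODL_of_Oloc R d n).
Proof. by move=> f; rewrite /Oloc_of_ODL; case: cid. Qed.

Lemma ODL_of_OlocK n : cancel (@ODL_of_Oloc R d n) (@Oloc_of_ODL n).
Proof. by move=> f; apply: ODL_of_Oloc_inj; rewrite Oloc_of_ODLK. Qed.

Definition Oloc_comp : composition (Oloc R d) := fun n k f g =>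
  Oloc_of_ODL (ODL_comp (ODL_of_Oloc f) (fun i => ODL_of_Oloc (g i))).

Lemma Tagged_Oloc_of_ODL m m' (f : ODL R d m) (g : ODL R d m') :
  Tagged (ODL R d) f = Tagged (ODL R d) g ->
  Tagged (Oloc R d) (Oloc_of_ODL f) = Tagged (Oloc R d) (Oloc_of_ODL g).
Proof.
by move/(congr1 (fun t : {m & ODL R d m} => Tagged (Oloc R d) (Oloc_of_ODL (tagged t)))).
Qed.

Lemma Oloc_comp_operad : is_operad Oloc_comp (Oloc0 R d 1).
Proof.
split=> [n k l f g h|n f]; rewrite /Oloc_comp.
  rewrite Oloc_of_ODLK.
  have -> : (fun i => ODL_of_Oloc (Oloc_of_ODL (ODL_comp (ODL_of_Oloc (g i))
      (fun j => ODL_of_Oloc (h i j))))) =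
      (fun i => ODL_comp (ODL_of_Oloc (g i)) (fun j => ODL_of_Oloc (h i j))).
    by apply: functional_extensionality_dep => i; rewrite Oloc_of_ODLK.
  apply: Tagged_Oloc_of_ODL.
  exact: (ODL_comp_assoc (ODL_of_Oloc f) (fun i => ODL_of_Oloc (g i))
            (fun i j => ODL_of_Oloc (h i j))).
have -> : ODL_of_Oloc (Oloc0 R d 1) = ODL_S0 R d 1.
  apply: ODL_eq; rewrite /= add_S0E; congr germ_of.
  by apply/funext => z /=; rewrite addr0.
by rewrite (Tagged_Oloc_of_ODL (ODL_comp_unit (ODL_of_Oloc f))) ODL_of_OlocK.
Qed.

Lemma Oloc_on_eq n (U : set (B R d n)) (F F' : B R d n -> R) :
  (forall z, U z -> F z = F' z) -> Oloc_on U F -> Oloc_on U F'.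
Proof.
move=> FF' [oU BU sF F0 DF0]; have BUx x : U (0, x) by exact: BU.
split=> //; first exact: smooth_on_eq oU FF' sF.
  by move=> x; rewrite -FF'.
by move=> x; rewrite -(DF0 x); apply/esym/nabla_p_eq; exact: near_open oU (BUx x) FF'.
Qed.

Lemma ODL_on_S0D n (U : set (B R d n)) F : Oloc_on U F -> ODL_on U (S0 n \+ F).
Proof. by move=> hF; exists F. Qed.

Lemma pairing_psum n (p : 'M[R]_(n, d)) x : pairing (psum p) x = pairing p (xdiag n x).
Proof.
rewrite [RHS]pairing_rows /psum.
have -> : pairing (\sum_i row i p) x = \sum_i pairing (row i p) x.
  by rewrite /pairing mulmx_suml linear_sum.
by apply: eq_bigr => i _; congr pairing; apply/matrixP => a b; rewrite !mxE [b]ord1.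
Qed.

Lemma cancel_loc (px pb ax ab cG cF : R) :
  px + pb + cG + (px + ax + cF) - (px + pb + (ax + ab)) = px + (cG + cF - ab).
Proof. by lra. Qed.

Section Local.
Variables (n : nat) (k : 'I_n -> nat).
Local Notation K := (\sum_i k i)%N.
Variables (F : B R d n -> R) (UF : set (B R d n)).
Variables (G : forall i, B R d (k i) -> R) (UG : forall i, set (B R d (k i))).
Arguments G : clear implicits.
Arguments UG : clear implicits.
Hypotheses (hF : Oloc_on UF F) (hG : forall i, Oloc_on (UG i) (G i)).
Arguments hG : clear implicits.

Local Notation F1 := (S0 n \+ F).
Local Notation G1 := (fun i => S0 (k i) \+ G i).

Definition block_psum (p : 'M[R]_(K, d)) : 'M[R]_(n, d) := \matrix_i psum (submxcol p i).

Lemma psum_block_psum p : psum (block_psum p) = psum p.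
Proof.
rewrite /psum; transitivity (\sum_i \sum_j row j (submxcol p i)).
  by apply: eq_bigr => i _; rewrite rowK.
rewrite -(@big_tagnat _ k _ 0 +%R (fun _ _ => true) (fun i j => row j (submxcol p i))).
by apply: eq_bigr => s _; rewrite -row_tagnat.
Qed.

Lemma implicit_eqs_locE : implicit_eqs_loc F UF G UG = implicit_eqs F1 UF G1 UG.
Proof.
apply/funext => z; apply/funext => w; apply/propext.
have [oUF _ sF _ _] := hF.
have oUG i : open (UG i) by have [] := hG i.
have sG i : smooth_on (UG i) (G i) by have [] := hG i.
have sG1 i : smooth_on (UG i) (G1 i).
  exact: (smooth_onD (oUG i) (smooth_on_S0 (oUG i)) (sG i)).
have E : in_domains UF UG z w ->
    block_psum z.1 + nabla_x (cup G) (z.1, w.2) = nabla_x (cup G1) (z.1, w.2) /\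
    xdiag n z.2 + nabla_p F (w.1, z.2) = nabla_p F1 (w.1, z.2).
  move=> [UGz UFz]; split.
    apply/row_matrixP => i; rewrite linearD /= rowK.
    rewrite (row_nabla_x_cup sG) // (row_nabla_x_cup sG1) //.
    rewrite nabla_xD; [by rewrite nabla_x_S0 | exact: (derive_S0 _ 0).1 | ].
    exact: smooth_on_differentiable (sG i) (UGz i).
  rewrite nabla_pD; [by rewrite nabla_p_S0 | exact: (derive_S0 _ 0).1 | ].
  exact: smooth_on_differentiable sF UFz.
by split=> -[dom e1 e2]; have [E1 E2] := E dom; split=> //; rewrite ?E1 ?E2 // -?E1 -?E2.
Qed.

Lemma phi_Hloc z w : implicit_eqs_loc F UF G UG z (w z) ->
  phi F1 G1 w z = S0 K z + Hloc F G w z.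
Proof.
move=> [_ E1 E2]; rewrite /phi /Hloc.
set A := nabla_x _ _ in E1 *; set X := nabla_p _ _ in E2 *.
rewrite -/(block_psum z.1) in E1.
have -> : cup G1 (z.1, (w z).2) = pairing (block_psum z.1) (w z).2 + cup G (z.1, (w z).2).
  rewrite /cup big_split /=; congr (_ + _); rewrite pairing_rows.
  by apply: eq_bigr => i _; rewrite /S0 /= rowK.
have -> : F1 ((w z).1, z.2) = pairing (w z).1 (xdiag n z.2) + F ((w z).1, z.2).
  by rewrite /= /S0 /= pairing_psum.
have -> : S0 K z = pairing (block_psum z.1) (xdiag n z.2).
  by rewrite -pairing_psum psum_block_psum.
set cG := cup G _; set cF := F _.
rewrite E1 E2 !pairingDl !pairingDr; exact: cancel_loc.
Qed.

End Local.
End OperadOloc.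

Theorem proposition5 (R : realType) (d : nat) (d_gt0 : (0 < d)%N) :
  (forall (n : nat) (k : 'I_n -> nat)
      (F : B R d n -> R) (UF : set (B R d n))
      (G : forall i, B R d (k i) -> R) (UG : forall i, set (B R d (k i))),
    ODL_on UF F -> (forall i, ODL_on (UG i) (G i)) ->
    unique_branch (implicit_eqs F UF G UG) /\
    (forall (V : set (B R d (\sum_i k i)%N)) w,
      is_branch (implicit_eqs F UF G UG) V w ->
      exists W, [/\ W `<=` V, ODL_on W (phi F G w) &
                    is_lagr_comp (lagr W (phi F G w)) F UF G UG]))
  /\
  (exists comp : composition (ODL R d),
    [/\ forall (n : nat) (k : 'I_n -> nat)
            (f : ODL R d n) (g : forall i, ODL R d (k i))
            (F : B R d n -> R) (UF : set (B R d n))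
            (G : forall i, B R d (k i) -> R) (UG : forall i, set (B R d (k i)))
            (V : set (B R d (\sum_i k i)%N)) w,
          ODL_on UF F -> (forall i, ODL_on (UG i) (G i)) ->
          sval f = germ_of F -> (forall i, sval (g i) = germ_of (G i)) ->
          is_branch (implicit_eqs F UF G UG) V w ->
          sval (comp n k f g) = germ_of (phi F G w),
        is_operad comp (ODL_S0 R d 1)
      & exists comp_loc : composition (Oloc R d),
        [/\ forall (n : nat) (k : 'I_n -> nat)
                (f : Oloc R d n) (g : forall i, Oloc R d (k i)),
              comp n k (ODL_of_Oloc f) (fun i => ODL_of_Oloc (g i))
              = ODL_of_Oloc (comp_loc n k f g),
            is_operad comp_loc (Oloc0 R d 1)
          & forall (n : nat) (k : 'I_n -> nat)
                (F : B R d n -> R) (UF : set (B R d n))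
                (G : forall i, B R d (k i) -> R)
                (UG : forall i, set (B R d (k i))),
              Oloc_on UF F -> (forall i, Oloc_on (UG i) (G i)) ->
              unique_branch (implicit_eqs_loc F UF G UG) /\
              (forall (V : set (B R d (\sum_i k i)%N)) w,
                is_branch (implicit_eqs_loc F UF G UG) V w ->
                (exists2 W, W `<=` V & Oloc_on W (Hloc F G w)) /\
                (forall (f : Oloc R d n) (g : forall i, Oloc R d (k i)),
                  sval f = germ_of F ->
                  (forall i, sval (g i) = germ_of (G i)) ->
                  sval (comp_loc n k f g) = germ_of (Hloc F G w)))]]).
Proof.
split=> [n k F UF G UG hF hG|]; first exact: branch_theorem.
exists (@ODL_comp R d); split.
- by move=> n k f g F UF G UG V w; exact: ODL_compE.
- exact: ODL_comp_operad.
exists (@Oloc_comp R d); split.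
- by move=> n k f g; rewrite Oloc_of_ODLK.
- exact: Oloc_comp_operad.
move=> n k F UF G UG hF hG.
have hF1 := ODL_on_S0D hF; have hG1 i := ODL_on_S0D (hG i).
have locE := implicit_eqs_locE hF hG.
split=> [|V w bw]; first by rewrite locE; exact: (branch_theorem hF1 hG1).1.
have [oV BV _ _ Ew] := bw.
have phiE z : V z -> phi (S0 n \+ F) (fun i => S0 (k i) \+ G i) w z = S0 _ z + Hloc F G w z.
  by move=> Vz; exact: phi_Hloc (Ew z Vz).
rewrite locE in bw; split.
  have [W [WV [Ht hHt HtE] _]] := (branch_theorem hF1 hG1).2 V w bw.
  exists W => //; apply: Oloc_on_eq hHt => z Wz.
  by apply: (addrI (S0 _ z)); rewrite -HtE // phiE //; exact: WV.
move=> f g fF gG; apply: add_S0_inj.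
have -> : add_S0 (sval (Oloc_comp f g)) = sval (ODL_of_Oloc (Oloc_comp f g)) by [].
rewrite Oloc_of_ODLK add_S0E (ODL_compE hF1 hG1 _ _ bw).
- apply/germ_ofP => z Bz.
  by apply: filterS (open_nbhs_nbhs (conj oV (BV z Bz))) => y /phiE.
- by rewrite /= fF add_S0E.
- by move=> i; rewrite /= gG add_S0E.
Qed.
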